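(* Let $n,L$ be positive integers, let $\mu$ be a distribution on $\{0,1\}^n$, let $T>0$ be a time bound and let $\varepsilon\in(0,1)$. Let $\Phi$ be a family of convex functions $\varphi:\Delta_L\to\mathbb R$, each equipped with a fixed choice of subgradient $\nabla\varphi(v)$ at every $v\in\Delta_L$. Assume that for every $\varphi\in\Phi$ and every $v\in\Delta_L$ we have $\nabla\varphi(v)\in[-1,1]^L$, and that $\nabla\varphi(v)$ can be computed from $v$ to $\ell_\infty$ accuracy $\varepsilon/4$ in nonuniform time $T_\Phi$. Then there exists $$T'=O\!\left(\frac{(T+T_\Phi)\log L}{\varepsilon^2}+L\cdot\mathrm{poly}(1/\varepsilon,\log L)\right)$$ such that for every $g^*:\{0,1\}^n\to\Delta_L$ there exists $s\in\mathsf{Ind}(g^*;T,\varepsilon)\cap\mathsf{Time}(T')$ with $$\mathsf H_\varphi(s)-\mathsf H_\varphi(g^* )\ \ge\ \mathsf D_\varphi(g^*\|s)-\varepsilon\quad\text{for every }\varphi\in\Phi.$$ Conversely, for every $T>0$ there exists $T'=O(T+T_\Phi)$ such that for every $g^*:\{0,1\}^n\to\Delta_L$ and every $\varphi\in\Phi$, $$\max_{s\in\mathsf{Ind}(g^*;T',\varepsilon/2)}\big(\mathsf H_\varphi(s)-\mathsf H_\varphi(g^* )\big)\ \le\ \min_{g\in\mathsf{Time}(T)}\mathsf D_\varphi(g^*\|g)+\varepsilon.$$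
   Context: $\Delta_L\subseteq[0,1]^L$ denotes the set of probability distributions (probability mass vectors) on $[L]=\{1,\dots,L\}$. $\mathsf{Time}(T)$ denotes the class of functions computable in nonuniform time $T$ (circuit complexity at most $T$). For $g^*,s:\{0,1\}^n\to\Delta_L$, $s\in\mathsf{Ind}(g^*;T,\varepsilon)$ means that for every $f:\{0,1\}^n\to[-1,1]^L$ computable in nonuniform time $T$, $\big|\mathbb E_{x\sim\mu}\langle s(x)-g^*(x),f(x)\rangle\big|\le\varepsilon$. For convex $\varphi:\Delta_L\to\mathbb R$ and $g:\{0,1\}^n\to\Delta_L$, $\mathsf H_\varphi(g):=-\mathbb E_{x\sim\mu}[\varphi(g(x))]$, and for $g^*,g:\{0,1\}^n\to\Delta_L$ the Bregman divergence is $\mathsf D_\varphi(g^*\|g):=\mathbb E_{x\sim\mu}\big[\varphi(g^*(x))-\varphi(g(x))-\langle g^*(x)-g(x),\nabla\varphi(g(x))\rangle\big]$, using the fixed choice of subgradient $\nabla\varphi$. *)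

(* Defs.v *)
From HB Require Import structures.
From mathcomp Require Import all_boot all_order all_algebra.
From mathcomp Require Import all_classical all_reals all_analysis.

Set Implicit Arguments.
Unset Strict Implicit.
Unset Printing Implicit Defensive.

Import Order.TTheory GRing.Theory Num.Theory.
Local Open Scope classical_set_scope.
Local Open Scope ring_scope.

(* Boolean circuits over the full binary basis, as straight-line programs.
   On an input of length m, wires 0, ..., m - 1 carry the input bits and gate
   number k drives wire m + k.  A gate or an output that refers to a wire that
   does not exist yet reads [false], so no well-formedness condition is needed
   and cyclic references are impossible. *)
Record gate := Gate {
  gate_op : bool -> bool -> bool;
  gate_left : nat;
  gate_right : nat }.

Record circuit := Circuit {
  circuit_gates : seq gate;
  circuit_outs : seq nat }.

Definition gate_step (vs : seq bool) (g : gate) : seq bool :=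
  rcons vs (gate_op g (nth false vs (gate_left g))
                      (nth false vs (gate_right g))).

Definition circuit_eval (c : circuit) (x : seq bool) : seq bool :=
  [seq nth false (foldl gate_step x (circuit_gates c)) k
     | k <- circuit_outs c].

(* Output bits count as nodes of the circuit: producing them takes time. *)
Definition circuit_size (c : circuit) : nat :=
  (size (circuit_gates c) + size (circuit_outs c))%N.

Section FixedPoint.
Variable R : realType.

(* Two's complement with b fractional bits: bit 0 has weight -2 and bit j + 1
   has weight 2^-j.  The range is [-2, 2[, so that both 1 and -1 are
   representable, and every representable number has exactly one code. *)
Definition fixed_point (b : nat) (u : nat -> bool) : R :=
  - 2 * (u 0%N)%:R + \sum_(j < b.+1) (u j.+1)%:R / 2 ^+ j.

(* A vector of length L is the concatenation of L words of b + 2 bits. *)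
Definition decode (b L : nat) (w : seq bool) : 'rV[R]_L :=
  \row_(i < L) fixed_point b (fun j => nth false w (i * b.+2 + j)%N).

Definition Time (n L T : nat) : set (n.-tuple bool -> 'rV[R]_L) :=
  [set h | exists (b : nat) (c : circuit),
    [/\ (circuit_size c <= T)%N,
        size (circuit_outs c) = (L * b.+2)%N &
        forall x : n.-tuple bool, decode b L (circuit_eval c x) = h x]].

End FixedPoint.

Section Distributions.
Variable R : realType.

Definition is_distribution (A : finType) (p : A -> R) : Prop :=
  (forall a, 0 <= p a) /\ \sum_a p a = 1.

Definition simplex (L : nat) : set 'rV[R]_L :=
  [set v | is_distribution (fun i => v 0 i)].

Definition dot (L : nat) (u v : 'rV[R]_L) : R := \sum_(i < L) u 0 i * v 0 i.

Definition expect (A : finType) (mu : A -> R) (F : A -> R) : R :=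
  \sum_a mu a * F a.

(* Membership in the cube [-1, 1]^L. *)
Definition in_cube (L : nat) (v : 'rV[R]_L) : Prop :=
  forall i, -1 <= v 0 i <= 1.

Definition is_subgradient (L : nat) (phi : 'rV[R]_L -> R)
    (grad : 'rV[R]_L -> 'rV[R]_L) : Prop :=
  forall u v, simplex u -> simplex v ->
    phi v + dot (u - v) (grad v) <= phi u.

(* [F], as a function on the simplex, is computable to l_oo accuracy [delta] in
   nonuniform time [T]: for every precision b there is a circuit of size at
   most T that maps the code of a distribution v with b-bit coordinates to the
   code (with b' fractional bits) of a vector within [delta] of F v. *)
Definition approx_computable (L : nat) (F : 'rV[R]_L -> 'rV[R]_L)
    (delta : R) (T : nat) : Prop :=
  forall b : nat, exists (b' : nat) (c : circuit),
    [/\ (circuit_size c <= T)%N,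
        size (circuit_outs c) = (L * b'.+2)%N &
        forall w : seq bool, size w = (L * b.+2)%N ->
          simplex (decode R b L w) ->
          forall i, `|decode R b' L (circuit_eval c w) 0 i
                      - F (decode R b L w) 0 i| <= delta].

Variables (n L : nat) (mu : n.-tuple bool -> R).
Implicit Types s g gstar : n.-tuple bool -> 'rV[R]_L.

Definition Ind gstar (T : nat) (eps : R) : set (n.-tuple bool -> 'rV[R]_L) :=
  [set s | (forall x, simplex (s x)) /\
    forall f : n.-tuple bool -> 'rV[R]_L,
      (forall x, in_cube (f x)) -> Time T f ->
      `|expect mu (fun x => dot (s x - gstar x) (f x))| <= eps].

Definition entropy (phi : 'rV[R]_L -> R) g : R :=
  - expect mu (fun x => phi (g x)).

Definition bregman (phi : 'rV[R]_L -> R) (grad : 'rV[R]_L -> 'rV[R]_L)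
    gstar g : R :=
  expect mu (fun x => phi (gstar x) - phi (g x)
                      - dot (gstar x - g x) (grad (g x))).

End Distributions.

(* Main.v *)
Require Import Defs.
From HB Require Import structures.
From mathcomp Require Import all_boot all_order all_algebra.
From mathcomp Require Import all_classical all_reals all_analysis.
From mathcomp Require Import zify ring lra.

(* The direct part is a multiplicative-weights argument.  The state consists of
   integer counters u_i(x), and the candidate s(x) is a dyadic rounding of
   softmax(step * u(x)).  As long as some test h - plus or minus an f in Time(T),
   or a computed gradient of some phi at s - has E<s - gstar, h> > eps, the counters
   are decreased by a rounding of h (up to a shift common to all i).  The
   potential E[log sum_i exp(step * u_i) - <gstar, step * u>] is nonnegative, starts
   at log L and loses a multiple of eps^2 at every update, so O(log L / eps^2)
   updates suffice.  In the end s is in Ind(gstar; T, eps), and the entropy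
   inequality holds because
     D(gstar || s) - (H(s) - H(gstar)) = E<s - gstar, grad phi(s)> <= eps.
   Normalization needs no division: among the vectors exp(step * (u_i - j)),
   truncated to dyadic numbers, take the first level j of total mass at most 1
   and give the missing mass to coordinate 0.  Since the counters take
   poly(1/eps, log L) values, table lookups and ripple-carry additions do this
   in size L * poly(1/eps, log L).

   For the converse, the subgradient inequality gives
     H(s) - H(gstar) - D(gstar || g) <= E<gstar - s, grad phi(g)>,
   and the approximate gradient of phi at g, clipped to [-1, 1]^L, is a test
   function computable in time O(T + TPhi). *)

Set Implicit Arguments.
Unset Strict Implicit.
Unset Printing Implicit Defensive.

Import Order.TTheory GRing.Theory Num.Theory.
Local Open Scope classical_set_scope.
Local Open Scope ring_scope.

(** * Straight-line derivations of Boolean functions *)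

Section Derivations.
Local Open Scope nat_scope.
Variable X : Type.
Implicit Types (A B C : set (X -> bool)) (f u v : X -> bool) (k m : nat).

(* [derives k A B]: at most k gates turn wires carrying the functions in A into
   wires carrying all the functions in B. *)
Inductive derives : nat -> set (X -> bool) -> set (X -> bool) -> Prop :=
| derives_sub k A B : B `<=` A -> derives k A B
| derives_gate k A B op u v : A u -> A v ->
    derives k (A `|` [set (fun x => op (u x) (v x))]) B -> derives k.+1 A B.

Lemma derives_mono k k' A A' B B' :
  k <= k' -> A `<=` A' -> B' `<=` B -> derives k A B -> derives k' A' B'.
Proof.
move=> lek sA sB H; elim: H k' A' B' lek sA sB => {k A B}.
  by move=> k A B BA k' A' B' _ sA sB; apply: derives_sub => f /sB/BA/sA.
move=> k A B op u v Au Av _ IH [//|k'] A' B' lek sA sB.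
apply: (@derives_gate _ _ _ op u v); [exact: sA|exact: sA|].
by apply: IH => //; apply: setSU.
Qed.

Lemma derives_keep k A B : derives k A B -> derives k A (A `|` B).
Proof.
elim=> {k A B} [k A B BA|k A B op u v Au Av _ IH].
  by apply: derives_sub => f [Af|/BA].
apply: (@derives_gate _ _ _ op _ _ Au Av).
apply: (derives_mono (leqnn _) (@subset_refl _ _) _ IH).
by move=> f [Af|Bf]; [left; left|right].
Qed.

Lemma derives_trans k1 k2 A B C :
  derives k1 A B -> derives k2 B C -> derives (k1 + k2) A C.
Proof.
move=> H; elim: H k2 C => {k1 A B} [k A B BA|k A B op u v Au Av _ IH] k2 C HC.
  by apply: derives_mono HC => //; exact: leq_addl.
by rewrite addSn; apply: (@derives_gate _ _ _ op _ _ Au Av); apply: IH.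
Qed.

Lemma derives_union k1 k2 A B C :
  derives k1 A B -> derives k2 A C -> derives (k1 + k2) A (B `|` C).
Proof.
move=> HB HC; apply: (derives_trans (derives_keep HB)).
have {}HC : derives k2 (A `|` B) C by apply: derives_mono HC => // f; left.
apply: derives_mono (derives_keep HC) => // f [Bf|Cf]; by [left; right|right].
Qed.

Lemma derives_cut k1 k2 A B C :
  derives k1 A B -> derives k2 (A `|` B) C -> derives (k1 + k2) A C.
Proof. by move=> HB; apply: derives_trans; apply: derives_keep. Qed.

Lemma derives_family k m A (B : nat -> set (X -> bool)) :
  (forall i, i < m -> derives k A (B i)) ->
  derives (m * k) A [set f | exists2 i, i < m & B i f].
Proof.
elim: m => [|m IH] H; first by apply: derives_sub => f [].
rewrite mulSn addnC.
have {}IH := IH (fun i (lt : i < m) => H i (ltnW lt)).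
apply: derives_mono (derives_union IH (H m (ltnSn m))) => //.
move=> f [i]; rewrite ltnS leq_eqVlt => /orP[/eqP-> Bf|lt Bf]; first by right.
by left; exists i.
Qed.

(* Shannon expansion on the first wire. *)
Lemma derives_lookup A (vs : seq (X -> bool)) (F : seq bool -> bool) :
  A (fun=> false) -> (forall v, List.In v vs -> A v) ->
  derives (2 ^ (size vs).+2) A [set (fun x => F [seq v x | v <- vs])].
Proof.
move=> A0 Avs.
(* One expansion uses two copies of the shorter lookup and three gates; subtracting 3 makes the
   recursion [k -> 2 * k + 3] close exactly. *)
suff : derives (2 ^ (size vs).+2 - 3) A [set (fun x => F [seq v x | v <- vs])].
  by apply: derives_mono => //; exact: leq_subr.
elim: vs F Avs => [|v vs IH] F Avs.
  apply: (@derives_gate 0 _ _ (fun _ _ => F [::]) _ _ A0 A0).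
  by apply: derives_sub => f ->; right.
have Av : A v by apply: Avs; left.
have {}IH b := IH (fun s => F (b :: s)) (fun w Hw => Avs w (or_intror Hw)).
have H := derives_keep (derives_union (IH true) (IH false)).
have -> : 2 ^ (size (v :: vs)).+2 - 3 =
    2 ^ (size vs).+2 - 3 + (2 ^ (size vs).+2 - 3) + 3.
  by rewrite /= !expnS; have := expn_gt0 2 (size vs); lia.
apply: derives_trans H _.
set ft := fun x => F (true :: _); set ff := fun x => F (false :: _).
apply: (@derives_gate _ _ _ andb v ft); [by left|by right; left|].
apply: (@derives_gate _ _ _ (fun a b => ~~ a && b) v ff).
- by left; left.
- by left; right; right.
apply: (@derives_gate _ _ _ orb (fun x => v x && ft x) (fun x => ~~ v x && ff x)).
- by left; right.
- by right.
apply: derives_sub => f ->; right; apply: funext => x /=.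
by rewrite /ft /ff; case: (v x) => //=; rewrite orbF.
Qed.
End Derivations.

(** * Arithmetic on bits *)

Section Bits.
Local Open Scope nat_scope.

Definition bit (k N : nat) : bool := odd (N %/ 2 ^ k).

Lemma bit0 N : bit 0 N = odd N.
Proof. by rewrite /bit divn1. Qed.

Lemma bitS k N : bit k.+1 N = bit k N./2.
Proof. by rewrite /bit expnS divnMA divn2. Qed.

Lemma bit_top k N : N < 2 ^ k.+1 -> bit k N = (2 ^ k <= N).
Proof.
move=> ltN; rewrite /bit; have p0 := expn_gt0 2 k.
have : N %/ 2 ^ k < 2 by rewrite ltn_divLR // -expnS.
rewrite -[X in _ = (X <= _)]mul1n -leq_divRL //.
by case: (N %/ 2 ^ k) => [|[|q]].
Qed.

Lemma bit_mod k M N : k < M -> bit k (N %% 2 ^ M) = bit k N.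
Proof.
move=> ltkM; have E : 2 ^ M = 2 * 2 ^ (M - k.+1) * 2 ^ k.
  by rewrite -expnS -expnD; congr (2 ^ _); lia.
rewrite {2}(divn_eq N (2 ^ M)) {3}E mulnA /bit divnMDl ?expn_gt0 //.
by rewrite oddD mulnA oddM oddM /= andbF.
Qed.

Definition num_of_bits (s : seq bool) : nat :=
  foldr (fun (b : bool) N => b + N.*2) 0 s.

Lemma num_of_bitsK m N : N < 2 ^ m -> num_of_bits [seq bit k N | k <- iota 0 m] = N.
Proof.
elim: m N => [|m IH] N; first by rewrite expn0 ltnS leqn0 => /eqP->.
rewrite expnS => ltN /=; rewrite bit0 -[RHS]odd_double_half; congr (_ + _.*2).
rewrite -[RHS]IH; last by lia.
rewrite (iotaDl 1 0 m) -map_comp; congr num_of_bits.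
by apply: eq_map => k /=; rewrite bitS.
Qed.

Lemma In_map_iota (V : Type) (F : nat -> V) m k v :
  List.In v [seq F i | i <- iota m k] -> exists2 i, m <= i < m + k & v = F i.
Proof.
move=> /List.in_map_iff [i [<- Hi]]; exists i => //; rewrite -mem_iota.
elim: (iota m k) Hi => //= j s IH [->|/IH]; rewrite inE ?eqxx // => ->.
by rewrite orbT.
Qed.

Lemma map_nth_iota (s : seq bool) k : size s = k ->
  [seq nth false s i | i <- iota 0 k] = s.
Proof. by move=> <-; exact: mkseq_nth. Qed.

Variable X : Type.
Implicit Types (A B : set (X -> bool)) (a b u N : X -> nat) (vs : seq (X -> bool)).

(** [N] need not be below [2 ^ M]: only its [M] low-order bits are meant, so the results on sums
    hold modulo [2 ^ M] and overflow is left to the callers. *)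
Definition bits (M : nat) (N : X -> nat) : set (X -> bool) :=
  [set f | exists2 k, k < M & f = fun x => bit k (N x)].

Lemma bits_recl M N :
  bits M.+1 N = [set (fun x => odd (N x))] `|` bits M (fun x => (N x)./2).
Proof.
apply/seteqP; split => f.
  case=> -[|k] ltk ->.
    by left; apply: funext => x; rewrite bit0.
  by right; exists k => //; apply: funext => x; rewrite bitS.
case=> [->|[k ltk ->]].
  by exists 0 => //; apply: funext => x; rewrite bit0.
by exists k.+1 => //; apply: funext => x; rewrite bitS.
Qed.

Lemma derives_bits k M A N :
  (forall j, j < M -> derives k A [set (fun x => bit j (N x))]) ->
  derives (M * k) A (bits M N).
Proof.
move=> H; apply: derives_mono (derives_family H) => //.
Qed.

(** Since [u x < 2 ^ m], its [m] bits determine [u x], and any function of it and of [vs] is a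
    single lookup on [m + size vs] wires. *)
Lemma derives_table A m u vs (G : nat -> seq bool -> bool) :
  A (fun=> false) -> (forall x, u x < 2 ^ m) -> bits m u `<=` A ->
  (forall v, List.In v vs -> A v) ->
  derives (2 ^ (m + size vs).+2) A
    [set (fun x => G (u x) [seq v x | v <- vs])].
Proof.
move=> A0 ltu Au Avs.
pose us := [seq (fun x => bit k (u x)) | k <- iota 0 m] : seq (X -> bool).
have szu : size us = m by rewrite size_map size_iota.
have := @derives_lookup _ A (us ++ vs)
  (fun s => G (num_of_bits (take m s)) (drop m s)) A0.
rewrite size_cat szu => H.
have {}H : derives (2 ^ (m + size vs).+2) A [set (fun x =>
    G (num_of_bits (take m [seq v x | v <- us ++ vs]))
      (drop m [seq v x | v <- us ++ vs]))].
  apply: H => v /List.in_app_iff[Hv|]; last exact: Avs.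
  by have [k ltk ->] := In_map_iota Hv; apply: Au; exists k.
apply: derives_mono H => // f ->; apply: funext => x /=.
rewrite map_cat take_size_cat ?size_map ?size_iota // drop_size_cat ?size_map ?size_iota //.
congr (G _ _); rewrite -[LHS](num_of_bitsK (ltu x)); congr num_of_bits.
by rewrite -map_comp.
Qed.

(** Ripple-carry addition: at each position parity gives the sum bit and majority the carry into the
    halved numbers. Two lookups on three wires cost [2 * 2 ^ 5 = 64] gates. *)
Lemma derives_add A M a b (c : X -> bool) :
  A (fun=> false) -> bits M a `<=` A -> bits M b `<=` A -> A c ->
  derives (M * 64) A (bits M (fun x => a x + b x + c x)).
Proof.
elim: M A a b c => [|M IH] A a b c A0 Aa Ab Ac.
  by apply: derives_sub => f [].
move: Aa Ab; rewrite !bits_recl !subUset => -[Aa Aa'] [Ab Ab'].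
pose vs : seq (X -> bool) := [:: (fun x => odd (a x)); (fun x => odd (b x)); c].
have Avs v : List.In v vs -> A v.
  by move=> /= [<-|[<-|[<-|]]] //; [exact: Aa|exact: Ab].
have Hs := derives_lookup (fun s => nth false s 0 (+) nth false s 1 (+) nth false s 2) A0 Avs.
have Hc := derives_lookup (fun s => let p := nth false s 0 in
  let q := nth false s 1 in let r := nth false s 2 in
  [|| p && q, p && r | q && r]) A0 Avs.
rewrite mulSn; have H := derives_keep (derives_union Hs Hc).
apply: derives_mono (derives_trans H (derives_union (derives_sub 0 _) (IH _ _ _ _ _ _ _ _)));
  last first.
- by right; right.
- by move=> f /Ab'; left.
- by move=> f /Aa'; left.
- by left.
- apply: (subset_trans _ (@subsetUr _ A _)); exact: subsetUl.
- move=> f [->|[k ltk ->]]; [left|right].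
    by apply: funext => x /=; rewrite !oddD oddb.
  exists k => //; apply: funext => x /=; congr (bit k _).
  by case: (odd (a x)) (odd_double_half (a x)); case: (odd (b x)) (odd_double_half (b x));
    case: (c x) => /=; lia.
- exact: subset_refl.
- by rewrite add0n !expnS expn0; lia.
Qed.

Lemma derives_sum A k M (Ns : seq (X -> nat)) : A (fun=> false) ->
  (forall N, List.In N Ns -> derives k A (bits M N)) ->
  derives (size Ns * (k + M * 64)) A (bits M (fun x => \sum_(N <- Ns) N x)).
Proof.
move=> A0; elim: Ns => [|N Ns IH] H.
  apply: derives_sub => f [j _ ->]; suff -> : (fun x : X => bit j (\sum_(N <- [::]) N x)) =
    (fun=> false) by [].
  by apply: funext => x; rewrite big_nil /bit div0n.
have HN := H N (or_introl erefl).
have {IH}HNs := IH (fun N' HN' => H N' (or_intror HN')).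
set S := (fun x => \sum_(N <- Ns) N x) in HNs *.
have Hadd : derives (M * 64) (A `|` (bits M N `|` bits M S))
    (bits M (fun x => N x + S x + false)).
  apply: derives_add; [by left| | |by left].
  - exact: (subset_trans (@subsetUl _ _ _) (@subsetUr _ _ _)).
  - exact: (subset_trans (@subsetUr _ _ _) (@subsetUr _ _ _)).
apply: derives_mono (derives_cut (derives_union HN HNs) Hadd).
- by rewrite /=; lia.
- exact: subset_refl.
move=> f [j ltj ->]; exists j => //; apply: funext => x.
by rewrite big_cons addn0.
Qed.

Lemma derives_mux A M (acc : X -> bool) a b :
  A (fun=> false) -> A acc -> bits M a `<=` A -> bits M b `<=` A ->
  derives (M * 32) A (bits M (fun x => if acc x then a x else b x)).
Proof.
move=> A0 Aacc Aa Ab; apply: derives_bits => j ltj.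
have Avs v : List.In v [:: acc; fun x => bit j (a x); fun x => bit j (b x)] -> A v.
  by move=> /= [<-|[<-|[<-|]]] //; [apply: Aa|apply: Ab]; exists j.
have := derives_lookup
  (fun s => if nth false s 0 then nth false s 1 else nth false s 2) A0 Avs.
by apply: derives_mono => // f ->; apply: funext => x /=; case: (acc x).
Qed.

End Bits.

(** * Circuits and fixed-point codes *)

Section Circuits.
Local Open Scope nat_scope.

Lemma size_run (gs : seq gate) (s : seq bool) :
  size (foldl gate_step s gs) = size s + size gs.
Proof.
elim: gs s => [|g gs IH] s /=; first by rewrite addn0.
by rewrite IH /gate_step size_rcons addSnnS.
Qed.

Section Simulation.
Variable X : Type.
Implicit Types (A B : set (X -> bool)) (vs : seq (X -> bool)).

Lemma derives_gates (gs : seq gate) vs A :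
  A (fun=> false) -> (forall v, List.In v vs -> A v) ->
  derives (size gs) A
    [set f | exists k, f = fun x => nth false (foldl gate_step [seq v x | v <- vs] gs) k].
Proof.
have wire vs' A' k : A' (fun=> false) -> (forall v, List.In v vs' -> A' v) ->
    A' (fun x => nth false [seq v x | v <- vs'] k).
  move=> A0; elim: vs' k => [|v vs' IH] k Avs.
    by rewrite (_ : (fun x => _) = (fun=> false)) //; apply: funext => x; rewrite nth_nil.
  case: k => [|k] /=; first by apply: (Avs v); left.
  by apply: IH => w Hw; apply: Avs; right.
elim: gs vs A => [|g gs IH] vs A A0 Avs /=.
  by apply: derives_sub => f [k ->]; exact: wire.
pose w k x := nth false [seq v x | v <- vs] k.
apply: (@derives_gate _ _ _ _ (gate_op g) (w (gate_left g)) (w (gate_right g)));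
  [exact: wire|exact: wire|].
set h := fun x => gate_op g _ _.
have := IH (rcons vs h) (A `|` [set h]).
move=> /(_ (or_introl A0)) {}IH.
have {}IH := IH _.
apply: derives_mono (IH _) => //; last first.
  move=> v; rewrite -cats1 => /List.in_app_iff[/Avs|]; first by left.
  by move=> [<-|//]; right.
move=> f [k ->]; exists k; apply: funext => x; rewrite map_rcons.
by [].
Qed.

Lemma derives_circuit (c : circuit) vs A :
  A (fun=> false) -> (forall v, List.In v vs -> A v) ->
  derives (size (circuit_gates c)) A
    [set f | exists k, f = fun x => nth false (circuit_eval c [seq v x | v <- vs]) k].
Proof.
move=> A0 Avs; have := derives_keep (derives_gates (circuit_gates c) A0 Avs).
apply: derives_mono => // f [k ->].
rewrite /circuit_eval; have [ltk|lek] := ltnP k (size (circuit_outs c)).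
  right; exists (nth 0 (circuit_outs c) k); apply: funext => x.
  by rewrite (nth_map 0).
left; rewrite (_ : (fun x => _) = (fun=> false)) //; apply: funext => x.
by rewrite nth_default // size_map.
Qed.

End Simulation.

Section Realization.
Variable n : nat.
Implicit Types (gs : seq gate) (A B : set (n.-tuple bool -> bool)).

(** The bound on [j] makes the set stable under appending gates: a position beyond the end reads
    [false] now but may change its value later. *)
Definition wires gs : set (n.-tuple bool -> bool) :=
  [set f | exists2 j, j < n + size gs &
           forall x : n.-tuple bool, nth false (foldl gate_step x gs) j = f x].

Definition inputs : set (n.-tuple bool -> bool) :=
  [set f | f = (fun=> false) \/ exists k, f = fun x : n.-tuple bool => nth false x k].

Lemma derives_wires k A B gs : derives k A B -> A `<=` wires gs ->
  exists2 gs', size gs' <= size gs + k & B `<=` wires gs'.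
Proof.
move=> H; elim: H gs => {k A B} [k A B BA|k A B op u v Au Av _ IH] gs sA.
  by exists gs; [exact: leq_addr|exact: subset_trans sA].
have [i lti ui] := sA _ Au; have [j ltj vj] := sA _ Av.
have sz (x : n.-tuple bool) : size (foldl gate_step x gs) = n + size gs.
  by rewrite size_run size_tuple.
have [|gs' szgs' sB] := IH (rcons gs (Gate op i j)).
  move=> f [/sA[p ltp fp]|->].
    exists p => [|x]; first by rewrite size_rcons addnS ltnW.
    by rewrite -cats1 foldl_cat /= /gate_step nth_rcons sz ltp.
  exists (n + size gs) => [|x]; first by rewrite size_rcons addnS.
  by rewrite -cats1 foldl_cat /= /gate_step nth_rcons sz ltnn eqxx /= ui vj.
by exists gs' => //; rewrite (leq_trans szgs') // size_rcons addSnnS.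
Qed.

Lemma derives_realize k B K (F : nat -> n.-tuple bool -> bool) :
  derives k inputs B -> (forall p, p < K -> B (F p)) ->
  exists c : circuit, [/\ circuit_size c <= k.+1 + K, size (circuit_outs c) = K &
    forall x : n.-tuple bool, circuit_eval c x = [seq F p x | p <- iota 0 K]].
Proof.
move=> H HF.
(* A constant gate is put first to supply the [false] contained in [inputs]; it accounts for the
   [.+1] in the size. *)
have [|gs szgs sB] := derives_wires (gs := [:: Gate (fun _ _ => false) 0 0]) H.
  move=> f; have false_wire : wires [:: Gate (fun _ _ => false) 0 0] (fun=> false).
    exists n => [|x]; first by rewrite addn1.
    by rewrite /= /gate_step nth_rcons size_tuple ltnn eqxx.
  case=> [->//|[i ->]].
  have [lti|lei] := ltnP i n; last first.
    rewrite (_ : (fun x : n.-tuple bool => _) = (fun=> false)) //.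
    by apply: funext => x; rewrite nth_default // size_tuple.
  exists i => [|x]; first by rewrite ltn_addr.
  by rewrite /= /gate_step nth_rcons size_tuple lti.
have outs : exists2 os : seq nat, size os = K & forall x : n.-tuple bool,
    [seq nth false (foldl gate_step x gs) o | o <- os] = [seq F p x | p <- iota 0 K].
  elim: K HF => [|K IH] HF; first by exists [::].
  have [os szos osP] := IH (fun p ltp => HF p (ltnW ltp)).
  have [j _ jP] := sB _ (HF K (ltnSn K)).
  exists (rcons os j) => [|x]; first by rewrite size_rcons szos.
  by rewrite -addn1 iotaD map_rcons map_cat /= osP jP cats1.
have [os szos osP] := outs.
exists (Circuit gs os); split => //.
by rewrite /circuit_size /= szos leq_add2r.
Qed.

End Realization.
End Circuits.

Section FixedPointCodes.
Variable R : realType.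
Implicit Types (b k N : nat) (u : nat -> bool).

Lemma eq_fixed_point b u u' :
  (forall j, (j < b.+2)%N -> u j = u' j) -> fixed_point R b u = fixed_point R b u'.
Proof.
move=> E; rewrite /fixed_point E //; congr (_ + _).
by apply: eq_bigr => j _; rewrite E // ltnS.
Qed.

Lemma fixed_pointS b u :
  fixed_point R b.+1 u = fixed_point R b u + (u b.+2)%:R / 2 ^+ b.+1.
Proof. by rewrite /fixed_point big_ord_recr /= addrA. Qed.

Lemma fixed_point_bit b N : (N < 2 ^ b.+1)%N ->
  fixed_point R b (fun j => if j is j'.+1 then bit (b - j') N else false) =
  N%:R / 2 ^+ b.
Proof.
elim: b N => [|b IH] N ltN.
  rewrite /fixed_point mulr0 add0r big_ord1 /= bit0.
  by case: N ltN => [|[|N]].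
rewrite fixed_pointS subnn bit0.
rewrite (eq_fixed_point (u' := fun j => if j is j'.+1 then bit (b - j') N./2 else false)).
  rewrite IH; last by move: ltN; rewrite expnS; lia.
  rewrite -{3}(odd_double_half N) natrD -muln2 natrM exprS.
  by field.
by move=> [|j] // ltj; rewrite subSn ?bitS //.
Qed.

(** The dropped bits have weights [2 ^ -(b + 1)] to [2 ^ -(b + k)], whose sum is the upper bound;
    the sign bit is kept, so truncation rounds down. *)
Lemma fixed_point_trunc b k u :
  0 <= fixed_point R (b + k) u - fixed_point R b u <= 1 / 2 ^+ b - 1 / 2 ^+ (b + k).
Proof.
elim: k => [|k IH]; first by rewrite addn0 !subrr lexx.
rewrite addnS fixed_pointS exprS.
have p0 : 0 < (2 ^+ (b + k) : R)^-1 by rewrite invr_gt0 exprn_gt0.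
rewrite !invfM; case: (u _) => /=; rewrite ?mulr1n ?mulr0n; move: IH p0;
  set y := (_ ^+ (_ + _))^-1; set z := (_ ^+ _)^-1; lra.
Qed.

Lemma fixed_point0 u : fixed_point R 0 u = - 2 * (u 0%N)%:R + (u 1%N)%:R.
Proof. by rewrite /fixed_point big_ord1 expr0 divr1. Qed.

Lemma fixed_point_bounds b u : -2 <= fixed_point R b u <= 2.
Proof.
have := fixed_point_trunc 0 b u; rewrite add0n expr0 divr1.
rewrite fixed_point0.
have : 0 < 1 / 2 ^+ b :> R by rewrite divr_gt0 // exprn_gt0.
by case: (u 0%N); case: (u 1%N) => /=; lra.
Qed.

(** Going to fewer bits is a truncation; going to more bits pads with zeros and preserves the
    value. *)
Lemma fixed_point_requantize b b' u :
  `|fixed_point R b' (fun j => (j < b.+2)%N && u j) - fixed_point R b u| <= 1 / 2 ^+ b'.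
Proof.
set v := fun j => _.
have -> : fixed_point R b u = fixed_point R b v.
  by apply: eq_fixed_point => j ltj; rewrite /v ltj.
have [leb|/ltnW leb] := leqP b' b.
  have := fixed_point_trunc b' (b - b') v; rewrite subnKC //.
  have : 0 < 1 / 2 ^+ b :> R by rewrite divr_gt0 // exprn_gt0.
  by rewrite ler_norml; lra.
suff -> : fixed_point R b' v = fixed_point R b v.
  by rewrite subrr normr0 divr_ge0 // exprn_ge0.
rewrite -(subnKC leb); elim: (b' - b)%N => [|k IH]; first by rewrite addn0.
rewrite addnS fixed_pointS IH /v (_ : ((b + k).+2 < b.+2)%N = false) ?mul0r ?addr0 //.
by rewrite !ltnS ltnNge leq_addr.
Qed.

(** The sign bit is constantly 0, since only nonnegative numbers are encoded; the other bits come
    highest first. *)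
Definition encode_bit b (N : nat -> nat) (p : nat) : bool :=
  if (p %% b.+2)%N is j.+1 then bit (b - j) (N (p %/ b.+2)%N) else false.

Lemma decode_encode b L (N : nat -> nat) :
  (forall i, (i < L)%N -> (N i < 2 ^ b.+1)%N) ->
  Defs.decode R b L [seq encode_bit b N p | p <- iota 0 (L * b.+2)] =
  \row_(i < L) ((N i)%:R / 2 ^+ b).
Proof.
move=> ltN; apply/rowP => i; rewrite !mxE -(fixed_point_bit (ltN i (ltn_ord i))).
apply: eq_fixed_point => j ltj.
have ltp : (i * b.+2 + j < L * b.+2)%N.
  by rewrite (leq_trans (_ : _ < i.+1 * b.+2)%N) ?leq_pmul2r // mulSn addnC ltn_add2r.
rewrite (nth_map 0%N) ?size_iota // nth_iota // add0n /encode_bit.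
by rewrite modnMDl divnMDl // modn_small // divn_small // addn0.
Qed.

Lemma Time_derives n L b k T (N : n.-tuple bool -> nat -> nat) :
  (forall x i, (i < L)%N -> (N x i < 2 ^ b.+1)%N) ->
  derives k (@inputs n)
    [set f | exists2 i, (i < L)%N & bits b.+1 (fun x => N x i) f] ->
  (k.+1 + L * b.+2 <= T)%N ->
  Time T (fun x => \row_(i < L) ((N x i)%:R / 2 ^+ b : R)).
Proof.
move=> ltN H leT; set B := [set f | _] in H.
have {}H : derives k (@inputs n) (@inputs n `|` B) by exact: derives_keep.
have [p ltp|c [szc szo cP]] := derives_realize (K := (L * b.+2)%N)
  (F := fun p x => encode_bit b (N x) p) H.
  rewrite /encode_bit; case E: (p %% b.+2)%N => [|j]; first by left; left.
  right; exists (p %/ b.+2)%N; first by rewrite ltn_divLR.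
  by exists (b - j)%N => //; rewrite ltnS leq_subr.
exists b, c; split=> //; first exact: leq_trans leT.
by move=> x; rewrite cP decode_encode //; exact: ltN.
Qed.

End FixedPointCodes.

Lemma norm_le_of (R : realType) (x e : R) : - e <= x -> x <= e -> `|x| <= e.
Proof. by move=> lo hi; rewrite ler_norml lo hi. Qed.

Lemma le_of_norm (R : realType) (x e : R) : `|x| <= e -> - e <= x /\ x <= e.
Proof. by rewrite ler_norml => /andP. Qed.

Lemma ln_le_exp2 (R : realType) L l : (0 < L)%N -> (L <= 2 ^ l)%N -> ln L%:R <= l%:R :> R.
Proof.
move=> L0 leL; rewrite -[leRHS]expRK ler_ln ?posrE ?ltr0n ?expR_gt0 //.
apply: (@le_trans _ _ (2 ^ l)%:R); first by rewrite ler_nat.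
rewrite natrX -[l%:R]mulr1 expRM_natl.
by apply: lerXn2r; rewrite ?nnegrE ?expR_ge0 //; have := expR_ge1Dx (1 : R); lra.
Qed.

(** * Softmax and its dyadic rounding *)

Section Softmax.
Variable R : realType.

(** Multiply by [1 - a]: the left side becomes at most 1, because [1 - a <= expR (- a)], and the
    right side becomes [1 + a ^+ 2 * (1 - 2 * a)]. *)
Lemma expR_le_quadratic (a : R) : 0 <= a <= 1 / 2 -> expR a <= 1 + a + 2 * a ^+ 2.
Proof.
move=> /andP[a0 a1].
have pos : 0 < 1 - a by lra.
rewrite -(ler_pM2r pos); apply: (@le_trans _ _ 1).
  have : expR a * (1 + - a) <= expR a * expR (- a).
    by rewrite ler_pM2l ?expR_gt0 // expR_ge1Dx.
  by rewrite expRN mulfV // gt_eqF ?expR_gt0.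
rewrite -subr_ge0 (_ : _ - 1 = a ^+ 2 * (1 - 2 * a)); last by ring.
by apply: mulr_ge0; [exact: sqr_ge0|lra].
Qed.

Variable L : nat.
Implicit Types (z a g : 'I_L -> R).

Definition partition_sum z : R := \sum_i expR (z i).
Definition logsumexp z : R := ln (partition_sum z).
Definition softmax z (i : 'I_L) : R := expR (z i) / partition_sum z.

Hypothesis L0 : (0 < L)%N.

Lemma partition_sum_gt0 z : 0 < partition_sum z.
Proof.
rewrite /partition_sum (bigD1 (Ordinal L0)) //= ltr_pwDl ?expR_gt0 //.
by apply: sumr_ge0 => i _; apply: expR_ge0.
Qed.

Lemma softmax_ge0 z i : 0 <= softmax z i.
Proof. by rewrite divr_ge0 ?expR_ge0 ?ltW ?partition_sum_gt0. Qed.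

Lemma sum_softmax z : \sum_i softmax z i = 1.
Proof. by rewrite /softmax -mulr_suml mulfV // gt_eqF ?partition_sum_gt0. Qed.

(** Each [z i] is at most [logsumexp z], as [expR (z i)] is one term of the partition sum, and a
    convex combination keeps the bound. *)
Lemma logsumexp_ge z g : is_distribution g -> \sum_i g i * z i <= logsumexp z.
Proof.
move=> [g0 g1]; rewrite -[leRHS]mul1r -g1 mulr_suml.
apply: ler_sum => i _; apply: ler_wpM2l => //.
rewrite -[leLHS]expRK ler_ln ?posrE ?expR_gt0 ?partition_sum_gt0 //.
rewrite /partition_sum (bigD1 i) //= lerDl.
by apply: sumr_ge0 => j _; apply: expR_ge0.
Qed.

(** The quadratic bound on [expR (a i)], averaged with the softmax weights, bounds the ratio of the
    partition sums by [1 + q + 2 * c ^+ 2]; then [ln (1 + x) <= x]. *)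
Lemma logsumexp_step z a c : (forall i, 0 <= a i <= c) -> c <= 1 / 2 ->
  logsumexp (fun i => z i + a i) <=
  logsumexp z + \sum_i softmax z i * a i + 2 * c ^+ 2.
Proof.
move=> ac c1.
have c0 : 0 <= c by have := ac (Ordinal L0); lra.
set q := \sum_i softmax z i * a i.
have q0 : 0 <= q.
  by apply: sumr_ge0 => i _; rewrite mulr_ge0 ?softmax_ge0 //; have /andP[] := ac i.
have pos : 0 < 1 + (q + 2 * c ^+ 2) by have := sqr_ge0 c; lra.
have le1 : partition_sum (fun i => z i + a i) <= partition_sum z * (1 + (q + 2 * c ^+ 2)).
  have -> : partition_sum z * (1 + (q + 2 * c ^+ 2)) =
      \sum_i expR (z i) * (1 + (a i + 2 * c ^+ 2)).
    under [RHS]eq_bigr do rewrite mulrDr mulr1 mulrDr.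
    rewrite !big_split /= -mulr_suml mulrDr mulr1 mulrDr; congr (_ + (_ + _)).
    rewrite mulr_sumr; apply: eq_bigr => i _.
    by rewrite mulrA mulrCA mulfV ?mulr1 // gt_eqF ?partition_sum_gt0.
  apply: ler_sum => i _; rewrite expRD ler_wpM2l ?expR_ge0 //.
  have /andP[ai0 aic] := ac i.
  apply: (le_trans (expR_le_quadratic _)); first by apply/andP; split => //; lra.
  by have := lerXn2r 2 ai0 c0 aic; lra.
rewrite -addrA -[q + _]addr0 /logsumexp.
apply: (@le_trans _ _ (ln (partition_sum z * (1 + (q + 2 * c ^+ 2))))).
  by rewrite ler_ln ?posrE ?mulr_gt0 ?partition_sum_gt0.
rewrite lnM ?posrE ?partition_sum_gt0 // lerD2l addr0.
by apply: le_ln1Dx; have := sqr_ge0 c; lra.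
Qed.

End Softmax.

Section Rounding.
Variables (R : realType) (L b M : nat) (step : R).
Hypothesis step0 : 0 < step.
Implicit Types (u : nat -> nat) (j : nat).

(** The cap at 2 bounds the number of bits, and a capped weight equals [2 ^ b.+1], which alone makes
    the level rejected. *)
Definition weight (j N : nat) : nat :=
  Num.truncn (2 ^+ b * Num.min 2 (expR (step * (N%:R - j%:R)))).

Definition total_weight u j : nat := (\sum_(0 <= i < L) weight j (u i))%N.
Definition accept u j : bool := (total_weight u j <= 2 ^ b)%N.

Fixpoint pick_level u k j : nat :=
  if k is k'.+1 then if accept u j then j else pick_level u k' j.+1 else j.

(* At an accepted level the residue for coordinate 0 is [2 ^ b] minus the other
   weights, without truncation. *)
Definition rounded u j i : nat :=
  if i is 0 then
    ((2 ^ b + \sum_(1 <= i < L) (2 ^ M - weight j (u i))) %% 2 ^ M)%N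
  else weight j (u i).

Lemma pick_level_accept u k j : accept u (j + k)%N -> accept u (pick_level u k j).
Proof.
elim: k j => [|k IH] j /=; first by rewrite addn0.
by case: ifP => // _; rewrite addnS -addSn; apply: IH.
Qed.

Lemma pick_level_min u k j : ~~ accept u j -> accept u (j + k)%N ->
  exists2 j', pick_level u k j = j'.+1 & ~~ accept u j'.
Proof.
elim: k j => [|k IH] j /=; first by rewrite addn0 => /negPf->.
move=> /[dup] rej /negPf-> acc.
have [acc'|rej'] := boolP (accept u j.+1).
  by exists j => //; case: k {IH acc} => [//|k] /=; rewrite acc'.
by apply: IH => //; rewrite addSnnS.
Qed.

Lemma weight_max j N : (weight j N <= 2 ^ b.+1)%N.
Proof.
rewrite -(ler_nat R); apply: (@le_trans _ _ (2 ^+ b * Num.min 2 (expR (step * (N%:R - j%:R))))).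
  by rewrite truncn_le mulr_ge0 ?exprn_ge0 // le_min expR_ge0 ler0n.
by rewrite natrX exprSr ler_wpM2l ?exprn_ge0 // ge_min lexx.
Qed.

Let scale0 : 0 < 2 ^+ b :> R. Proof. by rewrite exprn_gt0. Qed.

Lemma weight_le j N : (weight j N)%:R / 2 ^+ b <= expR (step * (N%:R - j%:R)).
Proof.
rewrite ler_pdivrMr // mulrC.
apply: (@le_trans _ _ (2 ^+ b * Num.min 2 (expR (step * (N%:R - j%:R))))).
  by rewrite truncn_le mulr_ge0 ?exprn_ge0 // le_min expR_ge0 ler0n.
by rewrite ler_wpM2l ?exprn_ge0 // ge_min lexx orbT.
Qed.

Lemma weight_ge j N : (weight j N <= 2 ^ b)%N ->
  expR (step * (N%:R - j%:R)) <= (weight j N)%:R / 2 ^+ b + (2 ^+ b)^-1.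
Proof.
move=> le_b.
have -> : (weight j N)%:R / 2 ^+ b + (2 ^+ b)^-1 = (weight j N).+1%:R / 2 ^+ b :> R.
  by rewrite -[(weight j N).+1%:R]natr1 mulrDl mul1r.
rewrite ler_pdivlMr // mulrC.
set E := expR _.
have /truncn_itv/andP[_] : 0 <= 2 ^+ b * Num.min 2 E.
  by rewrite mulr_ge0 ?exprn_ge0 // le_min expR_ge0 ler0n.
rewrite -/(weight j N) => lt.
have [leE|ltE] := leP E 2; first by move: lt; rewrite min_r // => /ltW.
(* If the cap were active, the weight would be at least [2 ^ b.+1], against [le_b]. *)
move: lt; rewrite min_l ?(ltW ltE) // -exprSr -natrX ltr_nat ltnS => ge.
by have := leq_trans ge le_b; rewrite leq_exp2l // ltnn.
Qed.

Hypothesis ltbM : (b < M)%N.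

Lemma rounded0 u j : (0 < L)%N -> accept u j ->
  (rounded u j 0 + \sum_(1 <= i < L) weight j (u i) = 2 ^ b)%N.
Proof.
move=> L0; rewrite /accept /total_weight big_ltn // => acc.
set S := (\sum_(1 <= i < L) _)%N in acc *.
have leS : (S <= 2 ^ b)%N by exact: leq_trans (leq_addl _ _) acc.
have ltM : (2 ^ b < 2 ^ M)%N by rewrite ltn_exp2l.
have /= -> : (rounded u j 0 = 2 ^ b - S)%N; last by rewrite subnK.
rewrite /rounded.
set Q := (\sum_(1 <= i < L) (2 ^ M - weight j (u i)))%N.
(* Every weight is replaced by its complement to [2 ^ M], so [Q] is [- S] modulo [2 ^ M]: the
   residue is obtained by additions only. *)
have QS : (Q + S = (L - 1) * 2 ^ M)%N.
  rewrite -sum_nat_const_nat -big_split /=; apply: eq_bigr => i _.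
  by rewrite subnK // (leq_trans (weight_max _ _)) // leq_exp2l.
have -> : (2 ^ b + Q = (L - 1) * 2 ^ M + (2 ^ b - S))%N by lia.
by rewrite modnMDl modn_small // (leq_ltn_trans _ ltM) // leq_subr.
Qed.

Lemma rounded_le u j i : (i < L)%N -> accept u j -> (rounded u j i <= 2 ^ b)%N.
Proof.
case: i => [|i] ltL acc; first by rewrite -(rounded0 ltL acc) leq_addr.
apply: leq_trans acc => /=; rewrite /total_weight (bigD1_seq i.+1) ?leq_addr //=.
  by rewrite mem_index_iota.
exact: iota_uniq.
Qed.

Definition rounded_row u j : 'rV[R]_L :=
  \row_(i < L) ((rounded u j i)%:R / 2 ^+ b).

Lemma sum_rounded u j : (0 < L)%N -> accept u j ->
  (\sum_(0 <= i < L) rounded u j i = 2 ^ b)%N.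
Proof.
move=> L0 acc; rewrite -(rounded0 L0 acc) big_ltn //; congr (_ + _)%N.
by apply: eq_big_nat => -[].
Qed.

Lemma rounded_simplex u j : (0 < L)%N -> accept u j -> simplex (rounded_row u j).
Proof.
move=> L0 acc; split => [i|]; first by rewrite mxE divr_ge0 // exprn_ge0.
under eq_bigr do rewrite mxE.
rewrite -mulr_suml -(big_mkord xpredT (fun i => (rounded u j i)%:R)) -natr_sum.
by rewrite sum_rounded // natrX mulfV // gt_eqF.
Qed.

(** At such a level each exponential is at most [1 / L], so the total mass is at most 1. *)
Lemma accept_top u j : (0 < L)%N ->
  (forall i, (i < L)%N -> ln L%:R <= step * (j%:R - (u i)%:R)) -> accept u j.
Proof.
move=> L0 H; rewrite /accept -(ler_nat R) natrX natr_sum.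
rewrite -[leRHS]mul1r -ler_pdivrMr // mulr_suml.
apply: (@le_trans _ _ (\sum_(0 <= i < L) L%:R^-1)).
  rewrite big_nat [leRHS]big_nat; apply: ler_sum => i /andP[_ iL].
  apply: (le_trans (weight_le _ _)).
  rewrite -[_%:R^-1]lnK ?posrE ?invr_gt0 ?ltr0n // ler_expR lnV ?posrE ?ltr0n //.
  by have := H i iL; rewrite mulrBr mulrBr; lra.
by rewrite sumr_const_nat subn0 -[_ *+ L]mulr_natr mulVf // pnatr_eq0 -lt0n.
Qed.

(** At level 0 every exponential is at least 1, and two or more of them exceed mass 1. *)
Lemma reject_bottom u : (1 < L)%N -> ~~ accept u 0.
Proof.
move=> L1; rewrite -ltnNge /total_weight.
apply: (@leq_trans (\sum_(0 <= i < L) 2 ^ b)).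
  rewrite sum_nat_const_nat subn0 -[X in (X < _)%N]mul1n ltn_pmul2r //.
  by rewrite expn_gt0.
apply: leq_sum => i _; rewrite /weight truncn_ge_nat.
  rewrite natrX -[leLHS]mulr1 ler_wpM2l ?exprn_ge0 // le_min ler1n /=.
  rewrite subr0 (le_trans _ (expR_ge1Dx _)) // lerDl.
  by rewrite mulr_ge0 // ltW.
by rewrite mulr_ge0 ?exprn_ge0 // le_min expR_ge0 ler0n.
Qed.

(** Both vectors are compared with [r = c * p], where [p] is the softmax and [c] the exact mass at
    the accepted level. Truncation costs [L / 2 ^ b] in total, rescaling [|c - 1|], and the residue
    at coordinate 0 costs [1 - A]; the last two are each at most [step + L / 2 ^ b]. *)
Lemma rounded_close u j : (0 < L)%N -> accept u j.+1 -> ~~ accept u j ->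
  \sum_(i < L) `|rounded_row u j.+1 0 i - softmax (fun i : 'I_L => step * (u i)%:R) i|
    <= 2 * step + 3 * (L%:R / 2 ^+ b).
Proof.
move=> L0 acc rej.
set z := (fun i : 'I_L => step * (u i)%:R); set p := softmax z.
pose a (i : 'I_L) : R := (weight j.+1 (u i))%:R / 2 ^+ b.
pose r (i : 'I_L) : R := expR (step * ((u i)%:R - j.+1%:R)).
pose c : R := partition_sum z * expR (- (step * j.+1%:R)).
have Z0 := partition_sum_gt0 L0 z.
have c0 : 0 < c by rewrite mulr_gt0 ?expR_gt0.
have rE i : r i = c * p i.
  rewrite /r /c /p /softmax mulrBr expRD -/(z i).
  by field; rewrite gt_eqF.
have sum_r : \sum_i r i = c.
  by under eq_bigr do rewrite rE; rewrite -mulr_sumr sum_softmax // mulr1.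
have ar i : a i <= r i <= a i + (2 ^+ b)^-1.
  rewrite weight_le weight_ge //; apply: leq_trans acc.
  rewrite /total_weight (bigD1_seq (i : nat)) ?leq_addr ?mem_index_iota //=.
  exact: iota_uniq.
pose A : R := \sum_i a i.
have AE : A = (total_weight u j.+1)%:R / 2 ^+ b.
  by rewrite /A /total_weight natr_sum big_mkord mulr_suml.
have A1 : A <= 1.
  by rewrite AE ler_pdivrMr // mul1r -natrX ler_nat.
have Ac : A <= c <= A + L%:R / 2 ^+ b.
  rewrite -sum_r; apply/andP; split; first by apply: ler_sum => i _; have /andP[] := ar i.
  have -> : L%:R / 2 ^+ b = \sum_(i < L) (2 ^+ b)^-1 :> R.
    by rewrite sumr_const card_ord mulr_natl.
  by rewrite -big_split; apply: ler_sum => i _; have /andP[] := ar i.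
(* One level down every exponential is larger by the factor [expR step], and the mass there exceeds
   1 by rejection; so [c > expR (- step) >= 1 - step]. *)
have c_ge : 1 - step <= c.
  have : 1 < expR step * c.
    apply: (@lt_le_trans _ _ ((total_weight u j)%:R / 2 ^+ b)).
      by rewrite ltr_pdivlMr // mul1r -natrX ltr_nat ltnNge.
    rewrite /total_weight natr_sum big_mkord mulr_suml -sum_r mulr_sumr.
    apply: ler_sum => i _; apply: (le_trans (weight_le _ _)).
    rewrite /r -expRD ler_expR -[j.+1%:R]natr1.
    by rewrite [leRHS](_ : _ = step * ((u i)%:R - j%:R)) //; ring.
  rewrite -(ltr_pM2l (expR_gt0 (- step))) mulrA -expRD addNr expR0 mulr1 mul1r.
  by have := expR_ge1Dx (- step); lra.
have Lb0 : 0 <= L%:R / 2 ^+ b :> R by rewrite divr_ge0 // exprn_ge0.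
set beta : R := L%:R / 2 ^+ b in Ac Lb0 *.
have c1 : `|c - 1| <= step + beta.
  have /andP[Ac1 Ac2] := Ac.
  have s0 := step0; apply: norm_le_of; lra.
have row_eq i : rounded_row u j.+1 0 i = a i + (i == Ordinal L0)%:R * (1 - A).
  rewrite mxE /a AE; case: (eqVneq i (Ordinal L0)) => [->|ne]; last first.
    rewrite /= mul0r addr0; case: i ne => -[|i] iL //.
  rewrite [true%:R]/(1 : R) mul1r -[nat_of_ord (Ordinal L0)]/0%N.
  have := rounded0 L0 acc; rewrite /total_weight (big_ltn L0).
  set S := (\sum_(1 <= i < L) _)%N => E.
  have {}E : (rounded u j.+1 0)%:R = 2 ^+ b - S%:R :> R.
    by apply/eqP; rewrite -subr_eq opprK -natrD E natrX.
  by rewrite E natrD; field; rewrite gt_eqF.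
apply: (@le_trans _ _ (\sum_(i < L) ((2 ^+ b)^-1 + `|c - 1| * p i +
    (i == Ordinal L0)%:R * (1 - A)))).
  apply: ler_sum => i _; rewrite row_eq.
  have p0 : 0 <= p i by exact: softmax_ge0.
  have -> : a i + (i == Ordinal L0)%:R * (1 - A) - p i =
      (a i - r i) + (c - 1) * p i + (i == Ordinal L0)%:R * (1 - A).
    by rewrite rE; ring.
  rewrite (le_trans (ler_normD _ _)) // lerD //; last first.
    by rewrite ger0_norm // mulr_ge0 // subr_ge0.
  rewrite (le_trans (ler_normD _ _)) // lerD //.
    by have /andP[? ?] := ar i; apply: norm_le_of; lra.
  by rewrite normrM (ger0_norm p0).
rewrite !big_split /= -mulr_sumr sum_softmax // -mulr_suml mulr1.
rewrite sumr_const card_ord -[_ *+ L]mulr_natl.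
have -> : \sum_(i < L) (i == Ordinal L0)%:R = 1 :> R.
  by rewrite (bigD1 (Ordinal L0)) // eqxx big1 => [|i /negPf->//]; exact: addr0.
rewrite mul1r -/beta.
have /andP[Ac1 Ac2] := Ac; move: c1 Ac1 Ac2; set y := `|_|.
by have s0 := step0; clearbody y; lra.
Qed.

End Rounding.

(** * Boolean circuits computing the rounding *)

Section RoundingCircuit.
Local Open Scope nat_scope.
Variable X : Type.
Implicit Types (A B : set (X -> bool)) (vs : seq (X -> bool)).

Definition words (L M : nat) (N : X -> nat -> nat) : set (X -> bool) :=
  [set f | exists2 i, i < L & bits M (fun x => N x i) f].

Lemma derives_word A m M (u : X -> nat) vs (G : nat -> seq bool -> nat) :
  A (fun=> false) -> (forall x, u x < 2 ^ m) -> bits m u `<=` A ->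
  (forall v, List.In v vs -> A v) ->
  derives (M * 2 ^ (m + size vs).+2) A
    (bits M (fun x => G (u x) [seq v x | v <- vs])).
Proof.
move=> A0 ltu Au Avs; apply: derives_bits => j _.
exact: (derives_table (fun N s => bit j (G N s)) A0 ltu Au Avs).
Qed.

Variables (R : realType) (L b M m : nat) (step : R) (u : X -> nat -> nat).
Variable A : set (X -> bool).
Hypotheses (L0 : 0 < L) (A0 : A (fun=> false)) (ltM : b.+1 < M).
Hypothesis leLM : L * 2 ^ b.+1 + 2 ^ M.-1 <= 2 ^ M.
Hypothesis ltu : forall x i, i < L -> u x i < 2 ^ m.
Hypothesis Au : words L m u `<=` A.

Let bitsA i : i < L -> bits m (fun x => u x i) `<=` A.
Proof. by move=> ltL f Hf; apply: Au; exists i. Qed.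

Let word_cost := M * 2 ^ m.+2.

Let derives_fun i (G : nat -> nat) : i < L ->
  derives word_cost A (bits M (fun x => G (u x i))).
Proof.
move=> ltL.
have := derives_word M (vs := [::]) (fun N _ => G N) A0 (fun x => ltu x ltL) (bitsA ltL).
by rewrite addn0; apply.
Qed.

Let W j i : X -> nat := fun x => weight b step j (u x i).

(** Adding [K = 2 ^ M.-1 - 2 ^ b - 1] turns the comparison with [2 ^ b] into the top bit of the sum;
    by [leLM] the sum stays below [2 ^ M]. *)
Lemma derives_accept j :
  derives (L.+1 * (word_cost + M * 64) + 8) A [set (fun x => accept L b step (u x) j)].
Proof.
set K := 2 ^ M.-1 - (2 ^ b).+1.
have ltK : (2 ^ b).+1 <= 2 ^ M.-1.
  by rewrite ltn_exp2l //; case: M ltM => // M' /=; rewrite ltnS.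
pose Ns := (fun=> K) :: [seq W j i | i <- iota 0 L].
have := @derives_sum _ A word_cost M Ns A0.
rewrite [size Ns]/= size_map size_iota => /(_ _)/derives_keep; rewrite /Ns => H.
set S := bits M _ in H.
have {}H : derives (L.+1 * (word_cost + M * 64)) A (A `|` S).
  apply: H => N [<-|]; first exact: (derives_fun (fun=> K) L0).
  by move=> Hi; have [i ltL ->] := In_map_iota Hi; exact: (derives_fun (weight b step j)).
apply: (derives_trans H).
pose top x := bit M.-1 (\sum_(N <- Ns) N x).
have Stop : S top by exists M.-1 => //; case: M ltM.
have := @derives_lookup _ (A `|` S) [:: top] (fun s => ~~ nth false s 0) (or_introl A0).
have Htop v : List.In v [:: top] -> (A `|` S) v by move=> [<-|//]; right.
move=> /(_ Htop); apply: derives_mono => // f ->; apply: funext => x /=.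
rewrite /top big_cons big_map.
have -> : \sum_(i <- iota 0 L) W j i x = total_weight L b step (u x) j.
  by rewrite /total_weight /index_iota subn0.
rewrite bit_top.
  rewrite -ltnNge /accept /K; move: ltK; set p := 2 ^ M.-1; set q := 2 ^ b; lia.
have : total_weight L b step (u x) j <= L * 2 ^ b.+1.
  rewrite /total_weight -[X in X * _]subn0 -sum_nat_const_nat.
  by apply: leq_sum => i _; exact: weight_max.
have -> : M.-1.+1 = M by case: M ltM.
rewrite /K; lia.
Qed.

Lemma derives_rounded j :
  derives (L * (word_cost + M * 64) + L * word_cost) A
    (words L b.+1 (fun x => rounded L b M step (u x) j)).
Proof.
pose Ns := (fun=> 2 ^ b) ::
  [seq (fun x => 2 ^ M - W j i x) | i <- iota 1 L.-1].
have H0 := @derives_sum _ A word_cost M Ns A0.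
have szN : size Ns = L by rewrite /= size_map size_iota prednK.
rewrite szN in H0.
have {}H0 : derives (L * (word_cost + M * 64)) A
    (bits b.+1 (fun x => rounded L b M step (u x) j 0)).
  apply: derives_mono (H0 _) => //.
    move=> f [k ltk ->]; exists k; first exact: ltn_trans ltM.
    apply: funext => x; rewrite /= bit_mod ?(ltn_trans ltk) //.
    by rewrite /Ns big_cons big_map /index_iota subn1.
  move=> N [<-|]; first exact: (derives_fun (fun=> 2 ^ b) L0).
  move=> Hi; have [i] := In_map_iota Hi; rewrite add1n prednK // => /andP[_ ltL] ->.
  exact: (derives_fun (fun N => 2 ^ M - weight b step j N)).
have H1 : derives (L * word_cost) A [set f | exists2 i, i < L & bits M (W j i) f].
  by apply: derives_family => i ltL; exact: (derives_fun (weight b step j)).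
apply: derives_mono (derives_union H0 H1) => //.
move=> f [[|i] ltL]; first by left.
move=> [k ltk ->]; right; exists i.+1 => //; exists k => //.
exact: ltn_trans ltM.
Qed.

(* A lookup on three wires costs 2 ^ 5 = 32 gates, a full adder 64. *)
Definition level_cost : nat :=
  L.+1 * (M * 2 ^ m.+2 + M * 64) + 8 +
  (L * (M * 2 ^ m.+2 + M * 64) + L * (M * 2 ^ m.+2)) + L * (M * 32).

(** A chain of multiplexers: the rounding at level [j] is computed, and its acceptance bit selects
    between it and the result for the higher levels. *)
Lemma derives_pick k j : derives (k.+1 * level_cost) A
  (words L b.+1 (fun x => rounded L b M step (u x) (pick_level L b step (u x) k j))).
Proof.
elim: k j => [|k IH] j.
  rewrite mul1n; apply: derives_mono (derives_rounded j) => //.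
  by rewrite /level_cost /word_cost; lia.
have H := derives_keep (derives_union (derives_union (derives_accept j)
  (derives_rounded j)) (IH j.+1)).
set acc := (fun x => accept L b step (u x) j) in H *.
set r1 := (fun x => rounded L b M step (u x) j) in H *.
set r2 := (fun x => rounded L b M step (u x) (pick_level L b step (u x) k j.+1)) in H *.
have Hmux : derives (L * (b.+1 * 32))
    (A `|` ([set acc] `|` words L b.+1 r1 `|` words L b.+1 r2))
    (words L b.+1 (fun x i => if acc x then r1 x i else r2 x i)).
  apply: derives_family => i ltL; apply: derives_mux; first by left.
  - by right; left; left.
  - by move=> f Hf; right; left; right; exists i.
  - by move=> f Hf; right; right; exists i.
apply: derives_mono (derives_trans H Hmux) => //.
  rewrite mulSn /level_cost -/word_cost.
  have : L * (b.+1 * 32) <= L * (M * 32) by rewrite leq_mul2l leq_mul2r (ltnW ltM) !orbT.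
  set x := L * (b.+1 * 32); set y := L * (M * 32); set z := L * word_cost.
  set t := L * (_ + _); set t' := L.+1 * (_ + _).
  by set w := k.+1 * _; lia.
move=> f [i ltL [p ltp ->]]; exists i => //; exists p => //.
apply: funext => x; congr (bit p _); rewrite /= /acc /r1 /r2.
by case: ifP.
Qed.

End RoundingCircuit.

(** * The boosting iteration *)

Section Expectation.
Variables (R : realType) (A : finType) (mu : A -> R).
Hypothesis mu_dist : is_distribution mu.
Implicit Types F G : A -> R.

Lemma expect_le F G : (forall x, F x <= G x) -> expect mu F <= expect mu G.
Proof.
by move=> FG; apply: ler_sum => x _; apply: ler_wpM2l => //; apply: mu_dist.1.
Qed.

Lemma expectD F G : expect mu (fun x => F x + G x) = expect mu F + expect mu G.
Proof. by rewrite /expect -big_split /=; apply: eq_bigr => x _; rewrite mulrDr. Qed.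

Lemma expectZ c F : expect mu (fun x => c * F x) = c * expect mu F.
Proof. by rewrite /expect mulr_sumr; apply: eq_bigr => x _; rewrite mulrCA. Qed.

Lemma expect_cst c : expect mu (fun=> c) = c.
Proof. by rewrite /expect -mulr_suml mu_dist.2 mul1r. Qed.

Lemma eq_expect F G : F =1 G -> expect mu F = expect mu G.
Proof. by move=> FG; apply: eq_bigr => x _; rewrite FG. Qed.

Lemma expectB F G : expect mu (fun x => F x - G x) = expect mu F - expect mu G.
Proof.
rewrite -[in RHS]mulN1r -expectZ -expectD; apply: eq_expect => x.
by rewrite mulN1r.
Qed.

End Expectation.

Lemma distribution_diff (R : realType) (A : finType) (p q w : A -> R) (c : R) :
  is_distribution p -> is_distribution q -> (forall a, `|w a| <= c) ->
  `|\sum_a (p a - q a) * w a| <= 2 * c.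
Proof.
move=> [p0 p1] [q0 q1] wc.
rewrite (le_trans (ler_norm_sum _ _ _)) //.
apply: (@le_trans _ _ (\sum_a (p a + q a) * c)); last first.
  by rewrite -mulr_suml big_split /= p1 q1.
apply: ler_sum => a _; rewrite normrM ler_pM //.
by rewrite (le_trans (ler_normB _ _)) // !ger0_norm.
Qed.

Section PotentialDrop.
Variables (R : realType) (L : nat).
Hypothesis L0 : (0 < L)%N.

(** For a distribution [g] this is the cross entropy of [g] relative to [softmax z]. *)
Definition potential (g z : 'I_L -> R) : R := logsumexp z - \sum_i g i * z i.

Lemma potential_ge0 g z : is_distribution g -> 0 <= potential g z.
Proof. by move=> gd; rewrite subr_ge0; apply: logsumexp_ge. Qed.

(** The first-order term of [logsumexp_step] is a softmax average; passing from softmax to the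
    nearby [s] costs [delta * c], since the increments lie in [[0, c]]. *)
Lemma potential_step (g z a s : 'I_L -> R) (c delta : R) :
  (forall i, 0 <= a i <= c) -> c <= 1 / 2 ->
  \sum_i `|s i - softmax z i| <= delta ->
  potential g (fun i => z i + a i) <=
  potential g z + \sum_i (s i - g i) * a i + delta * c + 2 * c ^+ 2.
Proof.
move=> ac c1 sd; have := logsumexp_step L0 z ac c1.
have c0 : 0 <= c by have := ac (Ordinal L0); lra.
have : \sum_i softmax z i * a i <= \sum_i s i * a i + delta * c.
  rewrite -lerBlDl -sumrB.
  apply: (@le_trans _ _ (\sum_i `|s i - softmax z i| * c)); last first.
    by rewrite -mulr_suml ler_wpM2r.
  apply: ler_sum => i _; rewrite -mulrBl; have /andP[a0 ac'] := ac i.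
  apply: (le_trans (ler_norm _)); rewrite normrM distrC (ger0_norm a0).
  by rewrite ler_wpM2l.
rewrite /potential.
have -> : \sum_i g i * (z i + a i) = \sum_i g i * z i + \sum_i g i * a i.
  by rewrite -big_split /=; apply: eq_bigr => i _; rewrite mulrDr.
have -> : \sum_i (s i - g i) * a i = \sum_i s i * a i - \sum_i g i * a i.
  by rewrite -sumrB; apply: eq_bigr => i _; rewrite mulrBl.
set x1 := \sum_i softmax z i * a i; set x2 := \sum_i s i * a i.
set x3 := \sum_i g i * a i; set x4 := \sum_i g i * z i.
set dc := delta * c; set cc := c ^+ 2.
set l1 := logsumexp _; set l2 := logsumexp _.
move: x1 x2 x3 x4 dc cc l1 l2 => x1 x2 x3 x4 dc cc l1 l2; lra.
Qed.

End PotentialDrop.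

(* The accuracy enters as [e >= 16 / eps] and the dimension as [L <= 2 ^ l]. *)
Section Schedule.
Local Open Scope nat_scope.
Variables e l : nat.

Definition frac_bits : nat := up_log 2 (2 * e).
Definition grain : nat := 2 ^ frac_bits.
(** The potential starts at most at [l] and each update lowers it by at least [1 / (16 * e ^ 2)];
    the factor [l.+1] would make it negative. *)
Definition rounds : nat := 16 * e ^ 2 * l.+1.
Definition max_count : nat := 5 * grain * rounds.
Definition count_bits : nat := up_log 2 max_count.+1.
(** One count is worth [1 / (20 * e * grain)] in the exponent, so the last level lies at least
    [l >= ln L] above every score and is accepted. *)
Definition levels : nat := max_count + 20 * e * grain * l.
(** With [L <= 2 ^ l] and [e <= 2 ^ e], the truncation error [L / 2 ^ out_bits] is at most
    [1 / (16 * e)]. *)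
Definition out_bits : nat := l + e + 4.
Definition sum_bits : nat := l + out_bits + 2.

Definition round_cost (L : nat) : nat := levels.+1 * level_cost L sum_bits count_bits.
Definition update_cost (L : nat) : nat :=
  L * (count_bits * 2 ^ (count_bits + frac_bits.+2).+2).

Lemma count_bits_gt N : N <= max_count -> N < 2 ^ count_bits.
Proof. by move=> leN; apply: leq_trans (up_logP _ _). Qed.

Lemma grain_bounds : 0 < e -> 2 * e <= grain <= 4 * e.
Proof.
move=> e0; have e1 : 1 < 2 * e by lia.
have := up_log_bounds (isT : 1 < 2) e1; rewrite /= -/frac_bits -/grain => /andP[lt ->].
rewrite /grain; have f0 : 0 < frac_bits by rewrite /frac_bits up_log_gt0.
by rewrite -(prednK f0) expnS; lia.
Qed.

End Schedule.

Section Boosting.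
Variables (R : realType) (L e l : nat).
Hypotheses (L1 : (1 < L)%N) (leL : (L <= 2 ^ l)%N) (e0 : (0 < e)%N).
Implicit Types (u : nat -> nat).

Let L0 : (0 < L)%N := ltnW L1.
Let ei : R := e%:R^-1.

(** One unit of a scaled increment moves the exponent by [1 / (20 * e)]; scaled increments are at
    most 5, so exponents move by at most [1 / (4 * e)]. *)
Definition step_size : R := 1 / (20 * e%:R * (grain e)%:R).

Let ei0 : 0 < ei. Proof. by rewrite invr_gt0 ltr0n. Qed.
Let ei1 : ei <= 1. Proof. by rewrite invf_le1 ?ler1n // ltr0n. Qed.
Let eE : e%:R * ei = 1. Proof. by rewrite mulfV // pnatr_eq0 -lt0n. Qed.

Let D0 : 0 < (grain e)%:R :> R.
Proof. by rewrite ltr0n expn_gt0. Qed.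

Lemma inv_grain_le : (grain e)%:R^-1 <= e%:R^-1 / 2 :> R.
Proof.
rewrite -invfM lef_pV2 ?posrE ?mulr_gt0 ?ltr0n ?expn_gt0 //.
by rewrite -natrM ler_nat mulnC; have /andP[] := grain_bounds e0.
Qed.

Lemma step_grain : step_size * (grain e)%:R = e%:R^-1 / 20.
Proof.
rewrite /step_size; field.
by rewrite !gt_eqF ?ltr0n ?expn_gt0.
Qed.

Lemma step_size_gt0 : 0 < step_size.
Proof. by rewrite divr_gt0 ?mulr_gt0 ?ltr0n ?expn_gt0. Qed.

Definition chosen u : nat := pick_level L (out_bits e l) step_size u (levels e l) 0.
Definition strategy_code u : nat -> nat := rounded L (out_bits e l) (sum_bits e l) step_size u (chosen u).
Definition strategy u : 'rV[R]_L :=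
  rounded_row L (out_bits e l) (sum_bits e l) step_size u (chosen u).
Definition scores u : 'I_L -> R := fun i => step_size * (u i)%:R.

Section Bounded.
Variable u : nat -> nat.
Hypothesis le_u : forall i, (i < L)%N -> (u i <= max_count e l)%N.

Lemma accept_levels : accept L (out_bits e l) step_size u (levels e l).
Proof.
apply: accept_top => // i ltL.
apply: (le_trans (ln_le_exp2 R L0 leL)).
have -> : l%:R = step_size * (20 * e%:R * (grain e)%:R * l%:R) :> R.
  rewrite /step_size; field.
  by rewrite !gt_eqF ?ltr0n ?expn_gt0.
rewrite ler_pM2l ?step_size_gt0 // lerBrDl -!natrM -natrD ler_nat.
by rewrite /levels leq_add2r le_u.
Qed.

Lemma chosen_level : exists2 j, chosen u = j.+1 &
  ~~ accept L (out_bits e l) step_size u j.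
Proof.
apply: pick_level_min; last by rewrite add0n accept_levels.
exact: (reject_bottom _ step_size_gt0 _ L1).
Qed.

Lemma accept_chosen : accept L (out_bits e l) step_size u (chosen u).
Proof. by apply: pick_level_accept; rewrite add0n accept_levels. Qed.

Lemma out_lt_sum : ((out_bits e l).+1 < sum_bits e l)%N.
Proof. by rewrite /sum_bits; lia. Qed.

Lemma strategy_simplex : simplex (strategy u).
Proof. exact: (rounded_simplex step_size_gt0 (ltnW out_lt_sum) L0 accept_chosen). Qed.

Lemma strategy_code_le i : (i < L)%N -> (strategy_code u i <= 2 ^ out_bits e l)%N.
Proof.
by move=> ltL; apply: (rounded_le step_size_gt0 (ltnW out_lt_sum) ltL accept_chosen).
Qed.

Lemma strategy_close :
  \sum_(i < L) `|strategy u 0 i - softmax (scores u) i| <= e%:R^-1 / 4.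
Proof.
have [j cE rej] := chosen_level; have acc := accept_chosen.
rewrite /strategy cE; rewrite cE in acc.
apply: (le_trans (rounded_close step_size_gt0 (ltnW out_lt_sum) L0 acc rej)).
have H1 : step_size <= ei / 40.
  have := step_grain; have := inv_grain_le; rewrite -/ei => H2 H3.
  have -> : step_size = ei / 20 * (grain e)%:R^-1.
    by rewrite -H3 mulfK // gt_eqF.
  apply: (@le_trans _ _ (ei / 20 * (ei / 2))).
    by rewrite ler_wpM2l // divr_ge0 // ltW.
  by have := ei1; have := ei0; nra.
have H2 : L%:R / 2 ^+ out_bits e l <= ei / 16.
  rewrite ler_pdivrMr ?exprn_gt0 // /out_bits !exprD mulrA mulrC.
  have -> : 2 ^+ 4 = 16 :> R by rewrite -natrX.
  have h3 : e%:R <= 2 ^+ e :> R by rewrite -natrX ler_nat ltnW // ltn_expl.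
  have h4 : L%:R <= 2 ^+ l :> R by rewrite -natrX ler_nat.
  have h5 : 1 <= 2 ^+ e * ei.
    by rewrite -[leLHS]eE ler_wpM2r // ltW.
  apply: (le_trans h4); set p := 2 ^+ l in h4 *; set q := 2 ^+ e in h5 *.
  have p0 : 0 <= p by rewrite exprn_ge0.
  have -> : 16 * (ei / 16 * (p * q)) = p * (q * ei) by field.
  by rewrite ler_peMr.
by rewrite -/ei; have := ei0; lra.
Qed.

End Bounded.

Section Update.
Variable sigma : R.
Hypothesis sigma1 : `|sigma| = 1.

Definition reading (s : seq bool) : R := fixed_point R (frac_bits e) (nth false s).
(* The shift by 3 keeps the increments nonnegative; softmax does not see it. *)
Definition increment (s : seq bool) : nat :=
  Num.truncn ((grain e)%:R * (3 - sigma * reading s)).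

Definition scaled_increment (s : seq bool) : R := (increment s)%:R / (grain e)%:R.

Lemma increment_bounds s :
  [/\ (increment s <= 5 * grain e)%N, 0 <= scaled_increment s <= 5 &
    `|scaled_increment s - (3 - sigma * reading s)| <= e%:R^-1 / 2].
Proof.
have /andP[lo hi] : - 2 <= sigma * reading s <= 2.
  have /andP[h1 h2] := fixed_point_bounds R (frac_bits e) (nth false s).
  have : `|sigma * reading s| <= 2.
    by rewrite normrM sigma1 mul1r; exact: norm_le_of.
  by move=> /le_of_norm[-> ->].
set y := 3 - sigma * reading s.
have y1 : 1 <= y by rewrite /y; lra.
have y5 : y <= 5 by rewrite /y; lra.
have /truncn_itv/andP[] : 0 <= (grain e)%:R * y by rewrite mulr_ge0 // ltW // (lt_le_trans ltr01).
rewrite -/(increment s) -natr1 => h1 h2.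
have le5 : (increment s <= 5 * grain e)%N.
  rewrite -(ler_nat R) natrM (le_trans h1) // mulrC ler_wpM2r //.
split=> //.
  by rewrite divr_ge0 //= ler_pdivrMr // -natrM ler_nat.
rewrite /scaled_increment.
have := inv_grain_le; have gi0 : 0 < (grain e)%:R^-1 :> R by rewrite invr_gt0.
have g1 : (grain e)%:R * (grain e)%:R^-1 = 1 :> R by rewrite mulfV // gt_eqF.
set gi := _^-1 in gi0 g1 * => gi_le.
have h3 : (increment s)%:R * gi <= y.
  have -> : y = (grain e)%:R * y * gi by rewrite mulrAC g1 mul1r.
  by rewrite ler_wpM2r // ltW.
have h4 : y <= (increment s)%:R * gi + gi.
  have -> : y = (grain e)%:R * y * gi by rewrite mulrAC g1 mul1r.
  by rewrite -[X in _ + X]mul1r -mulrDl ler_wpM2r // ltW.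
by apply: norm_le_of; lra.
Qed.

(** With [w = 1 / e], quantizing the test loses [w ^ 2 / 20], the distance from softmax
    [w ^ 2 / 16], and the second-order term [w ^ 2 / 8]; together [19 / 80 * w ^ 2]. *)
Lemma potential_update u (g v : 'rV[R]_L) (bs : nat -> seq bool) :
  (forall i, (i < L)%N -> (u i <= max_count e l)%N) -> simplex g ->
  (forall i : 'I_L, v 0 i = reading (bs i)) ->
  potential (fun i => g 0 i) (scores (fun i => u i + increment (bs i))%N) <=
  potential (fun i => g 0 i) (scores u) +
    (- (e%:R^-1 / 20)) * dot (strategy u - g) (sigma *: v) + 19 / 80 * e%:R^-1 ^+ 2.
Proof.
move=> le_u gd vE.
pose a (i : 'I_L) : R := step_size * (increment (bs i))%:R.
pose y (i : 'I_L) : R := scaled_increment (bs i).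
have aE i : a i = ei / 20 * y i.
  by rewrite /a /y /scaled_increment /ei -step_grain; field; rewrite gt_eqF.
have -> : scores (fun i => u i + increment (bs i))%N = (fun i => scores u i + a i).
  by apply: funext => i; rewrite /scores natrD mulrDr.
have ac i : 0 <= a i <= ei / 4.
  rewrite aE; have [_ /andP[y0 y5] _] := increment_bounds (bs i); rewrite -/(y i) in y0 y5.
  by have := ei0; nra.
have c1 : ei / 4 <= 1 / 2 by have := ei1; lra.
apply: (le_trans (potential_step L0 (fun i => g 0 i) ac c1 (strategy_close le_u))).
have sd := strategy_simplex le_u.
have E1 : \sum_i (strategy u 0 i - g 0 i) * a i =
    ei / 20 * \sum_i (strategy u 0 i - g 0 i) * y i.
  by rewrite mulr_sumr; apply: eq_bigr => i _; rewrite aE mulrCA.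
have E2 : \sum_i (strategy u 0 i - g 0 i) * y i =
    - dot (strategy u - g) (sigma *: v) +
    \sum_i (strategy u 0 i - g 0 i) * (y i - (3 - sigma * reading (bs i))).
  have -> : - dot (strategy u - g) (sigma *: v) =
      \sum_i (strategy u 0 i - g 0 i) * (3 - sigma * reading (bs i)).
    (* Both vectors sum to 1, so the shift by 3 drops out. *)
    have E3 : \sum_i (strategy u 0 i - g 0 i) * 3 = 0.
      by rewrite -mulr_suml sumrB sd.2 gd.2 subrr mul0r.
    rewrite -[LHS]add0r -[X in X + _]E3 /dot -sumrB; apply: eq_bigr => i _.
    by rewrite !mxE vE -mulrBr.
  by rewrite -big_split /=; apply: eq_bigr => i _; rewrite -mulrDr; congr (_ * _); ring.
have E4 : \sum_i (strategy u 0 i - g 0 i) * (y i - (3 - sigma * reading (bs i))) <= ei.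
  have := distribution_diff (w := fun i => y i - (3 - sigma * reading (bs i)))
    (c := ei / 2) sd gd.
  case/(_ _)/le_of_norm => [i|_]; first by have [] := increment_bounds (bs i).
  by move=> H; apply: (le_trans H); lra.
rewrite E1 E2; set d := dot _ _; set r := \sum_i _ * _ in E4 *.
set p := potential _ _; rewrite -/ei.
have := ei0; clearbody d r p; move: ei E4 => w; nra.
Qed.

End Update.
End Boosting.

(** A gap of [7 * w] gains [7 / 20 * w ^ 2] against a loss of [19 / 80 * w ^ 2]; the net coefficient
    [9 / 80] exceeds [1 / 16]. *)
Lemma drop_bound (R : realType) (w d p q K : R) : 0 < w -> 7 * w <= d ->
  p <= K - q * (w ^+ 2 / 16) ->
  p + (- (w / 20) * d + 19 / 80 * w ^+ 2) <= K - (q + 1) * (w ^+ 2 / 16).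
Proof.
move=> w0 wd pK; have : w * (7 * w) <= w * d by rewrite ler_pM2l.
by have := mulr_gt0 w0 w0; rewrite expr2 in pK *; lra.
Qed.

Section Iteration.
Variables (R : realType) (n L e l T : nat) (mu : n.-tuple bool -> R).
Variable gstar : n.-tuple bool -> 'rV[R]_L.
Hypotheses (L1 : (1 < L)%N) (leL : (L <= 2 ^ l)%N) (e0 : (0 < e)%N).
Hypothesis mu_dist : is_distribution mu.
Hypothesis gstar_simplex : forall x, simplex (gstar x).
Implicit Types (u : n.-tuple bool -> nat -> nat).

Let L0 : (0 < L)%N := ltnW L1.

Definition iteration_cost : nat := (round_cost e l L + T + update_cost e l L)%N.

Definition output_words u : set (n.-tuple bool -> bool) :=
  words L (out_bits e l).+1 (fun x => strategy_code R L e l (u x)).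

Definition mean_potential u : R :=
  expect mu (fun x => potential (fun i => gstar x 0 i) (@scores R L e (u x))).

(** The loop invariant after [t] updates: the first clause keeps the lookup tables small, the last
    one bounds the number of updates. *)
Definition reached (t : nat) u : Prop :=
  [/\ forall x i, (u x i <= 5 * grain e * t)%N,
      derives (t * iteration_cost) (@inputs n) (words L (count_bits e l) u) &
      mean_potential u <= l%:R - t%:R * (e%:R^-1 ^+ 2 / 16)].

(* Of the gap [eps >= 16 / e], an approximate gradient may use half, and
   quantizing the test costs at most another [1 / e]. *)
Definition violated u : Prop := exists (sigma : R) (vs : nat -> seq (n.-tuple bool -> bool)),
  [/\ `|sigma| = 1,
      forall i, size (vs i) = (frac_bits e).+2,
      derives T (@inputs n `|` output_words u)
        [set f | exists2 i, (i < L)%N & List.In f (vs i)] &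
      7 / e%:R <= expect mu (fun x => dot (strategy R L e l (u x) - gstar x)
        (sigma *: \row_(i < L) reading R e [seq v x | v <- vs i]))].

Lemma reached0 : reached 0 (fun _ _ => 0%N).
Proof.
split=> [x i|| ]; first exact: leq0n.
  apply: derives_sub => f [i _ [k _ ->]]; left.
  by apply: funext => x; rewrite /bit div0n.
rewrite mul0r subr0 /mean_potential -[leRHS](expect_cst mu_dist).
apply: (expect_le mu_dist) => x; rewrite /potential big1 => [|i _]; last first.
  by rewrite /scores mulr0 mulr0.
rewrite subr0 /logsumexp /partition_sum.
rewrite (eq_bigr (fun=> 1)) => [|i _]; last by rewrite /scores mulr0 expR0.
rewrite sumr_const card_ord; exact: ln_le_exp2.
Qed.

Lemma max_count_bound t u : (t <= rounds e l)%N ->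
  (forall x i, (u x i <= 5 * grain e * t)%N) ->
  forall x i, (u x i <= max_count e l)%N.
Proof.
by move=> let_ H x i; rewrite (leq_trans (H x i)) // /max_count leq_mul2l let_ orbT.
Qed.

Lemma derives_output u : (forall x i, (u x i <= max_count e l)%N) ->
  derives (round_cost e l L) (@inputs n `|` words L (count_bits e l) u) (output_words u).
Proof.
move=> le_u; apply: derives_pick => //.
- exact: (or_introl (or_introl erefl)).
- by rewrite /sum_bits; lia.
- have -> : sum_bits e l = (l + (out_bits e l).+1).+1 by rewrite /sum_bits; lia.
  rewrite [leqRHS]expnS mul2n -addnn leq_add2r expnD.
  by rewrite leq_mul2r leL orbT.
- by move=> x i _; apply: count_bits_gt.
Qed.

Lemma iterate t u : (t < rounds e l)%N -> reached t u -> violated u ->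
  exists u', reached t.+1 u'.
Proof.
move=> ltt [le_u der_u pot_u] [sigma [vs [sigma1 szvs der_vs viol]]].
pose bs i x := [seq v x | v <- vs i].
exists (fun x i => (u x i + increment e sigma (bs i x))%N).
have le_max := max_count_bound (ltnW ltt) le_u.
split=> [x i||].
- have [h _ _] := increment_bounds e0 sigma1 (bs i x).
  by rewrite mulnS addnC leq_add.
(* The circuit is extended by the rounding, by the violating test, and by a table lookup for every
   bit of the updated counters. *)
- have H1 := derives_keep der_u.
  have H2 := derives_trans H1 (derives_keep (derives_output le_max)).
  set A2 := _ `|` output_words u in H2.
  have H3 : derives T A2 [set f | exists2 i, (i < L)%N & List.In f (vs i)].
    by apply: derives_mono der_vs => // f [|]; [left; left|right].
  have {H3}H3 := derives_trans H2 (derives_keep H3).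
  set A3 := A2 `|` _ in H3.
  have H4 : derives (update_cost e l L) A3 (words L (count_bits e l)
      (fun x i => u x i + increment e sigma (bs i x))%N).
    apply: derives_family => i ltL; rewrite -(szvs i).
    apply: (derives_word _ (fun N s => N + increment e sigma s)%N).
    + by left; left; left; left.
    + by move=> x; apply: count_bits_gt.
    + by move=> f Hf; left; left; right; exists i.
    + by move=> v Hv; right; exists i.
  apply: derives_mono (derives_trans H3 H4) => //.
  by rewrite mulSn /iteration_cost; lia.
- have le_each x : potential (fun i => gstar x 0 i)
      (@scores R L e (fun i => u x i + increment e sigma (bs i x))%N) <=
    potential (fun i => gstar x 0 i) (@scores R L e (u x)) +
      ((- (e%:R^-1 / 20)) * dot (strategy R L e l (u x) - gstar x)
        (sigma *: \row_(i < L) reading R e (bs i x)) + 19 / 80 * e%:R^-1 ^+ 2).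
    rewrite addrA; apply: (potential_update L1 leL e0 sigma1 (bs := fun i => bs i x)) => //.
    by move=> i; rewrite mxE.
  have := expect_le mu_dist le_each.
  rewrite [leRHS]expectD [X in _ <= _ + X]expectD [X in _ <= _ + (X + _)]expectZ expect_cst // -/(mean_potential u) => H.
  apply: (le_trans H).
  rewrite -[t.+1%:R]natr1.
  by apply: drop_bound viol pot_u; rewrite invr_gt0 ltr0n.
Qed.

Lemma exists_unviolated : exists t u,
  [/\ (t <= rounds e l)%N, reached t u & ~ violated u].
Proof.
apply: contrapT => none.
have all_reached t : (t <= rounds e l)%N -> exists u, reached t u.
  elim: t => [|t IH] let_; first by exists (fun _ _ => 0%N); exact: reached0.
  have [u ru] := IH (ltnW let_).
  apply: (iterate let_ ru); apply: contrapT => nv; apply: none.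
  by exists t, u; split=> //; exact: ltnW.
have [u [_ _ pot_u]] := all_reached _ (leqnn _).
have pot0 : 0 <= mean_potential u.
  rewrite -(expect_cst mu_dist 0); apply: (expect_le mu_dist) => x.
  by apply: potential_ge0 => //; exact: gstar_simplex.
(* The full number of rounds would consume [l.+1], more than the initial [l], contradicting
   [pot0]. *)
have : (rounds e l)%:R * (e%:R^-1 ^+ 2 / 16) = l.+1%:R :> R.
  rewrite /rounds !natrM ?natrX; field.
  by rewrite pnatr_eq0 -lt0n.
by move: pot_u => /[swap] ->; rewrite -[l.+1%:R]natr1; lra.
Qed.

Lemma Time_strategy t u T' : (t <= rounds e l)%N -> reached t u ->
  ((rounds e l * iteration_cost + round_cost e l L).+1 + L * (out_bits e l).+2 <= T')%N ->
  Time T' (fun x => strategy R L e l (u x)).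
Proof.
move=> let_ [le_u der_u _] leT.
have le_max := max_count_bound let_ le_u.
have lt_code x i : (i < L)%N ->
    (strategy_code R L e l (u x) i < 2 ^ (out_bits e l).+1)%N.
  move=> ltL; rewrite (leq_ltn_trans (strategy_code_le R L1 leL e0 _ ltL)) //.
  by rewrite ltn_exp2l.
apply: (Time_derives R lt_code (derives_cut der_u (derives_output le_max))).
apply: leq_trans leT; rewrite leq_add2r ltnS leq_add2r leq_mul2r.
by rewrite let_ orbT.
Qed.

End Iteration.

Lemma dot_diffZ (R : realType) (L : nat) (s g w : 'rV[R]_L) sigma :
  dot (s - g) (sigma *: w) = \sum_i (s 0 i - g 0 i) * (sigma * w 0 i).
Proof. by apply: eq_bigr => i _; rewrite !mxE. Qed.

(** * Properties of an unviolated state *)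

Section Tests.
Variables (R : realType) (n L e l T : nat) (mu : n.-tuple bool -> R).
Variable gstar : n.-tuple bool -> 'rV[R]_L.
Hypotheses (L1 : (1 < L)%N) (leL : (L <= 2 ^ l)%N) (e0 : (0 < e)%N).
Hypothesis mu_dist : is_distribution mu.
Hypothesis gstar_simplex : forall x, simplex (gstar x).
Variable u : n.-tuple bool -> nat -> nat.
Hypothesis le_u : forall x i, (u x i <= max_count e l)%N.

(** This serves both kinds of test: [vs] carries the input bits when [c] computes a test function,
    and the code of the strategy when [c] computes a gradient. Inaccuracy and requantization cost
    [2 * delta + 1 / e], which leaves at least [7 / e] of the gap. *)
Lemma violated_intro (b : nat) (c : circuit) (vs : seq (n.-tuple bool -> bool))
    (h : n.-tuple bool -> 'rV[R]_L) (sigma delta eps : R) :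
  (circuit_size c <= T)%N ->
  (forall v, List.In v vs -> (@inputs n `|` output_words R L e l u) v) ->
  (forall x i, `|Defs.decode R b L (circuit_eval c [seq v x | v <- vs]) 0 i - h x 0 i| <= delta) ->
  `|sigma| = 1 -> 16 / e%:R <= eps -> 4 * delta <= eps ->
  eps <= expect mu (fun x => dot (strategy R L e l (u x) - gstar x) (sigma *: h x)) ->
  violated e l T mu gstar u.
Proof.
move=> szc Avs close sigma1 eps_e eps_d viol.
pose w i j x := (j < b.+2)%N &&
  nth false (circuit_eval c [seq v x | v <- vs]) (i * b.+2 + j).
pose ws i := [seq w i j | j <- iota 0 (frac_bits e).+2] : seq (n.-tuple bool -> bool).
exists sigma, ws; split=> //.
- by move=> i; rewrite size_map size_iota.
- have A0 : (@inputs n `|` output_words R L e l u) (fun=> false) by left; left.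
  have H := derives_keep (derives_circuit c A0 Avs).
  apply: (derives_mono _ (@subset_refl _ _) _ H).
    exact: leq_trans (leq_addr _ _) szc.
  move=> f [i _ Hf]; have [j _ ->] := In_map_iota Hf; rewrite /w.
  by case: (j < b.+2)%N => /=; [right; exists (i * b.+2 + j)%N|left].
set v := fun x => \row_(i < L) reading R e [seq v x | v <- ws i].
have v_close x i : `|v x 0 i - h x 0 i| <= delta + e%:R^-1 / 2.
  have := fixed_point_requantize R b (frac_bits e) (fun j =>
    nth false (circuit_eval c [seq v x | v <- vs]) (i * b.+2 + j)).
  have -> : fixed_point R (frac_bits e) (fun j => (j < b.+2)%N && nth false
      (circuit_eval c [seq v x | v <- vs]) (i * b.+2 + j)) = v x 0 i.
    rewrite mxE /reading; apply: eq_fixed_point => j ltj.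
    by rewrite -map_comp (nth_map 0%N) ?size_iota // nth_iota.
  have := close x i; rewrite mxE.
  have := inv_grain_le R e0; rewrite /grain natrX -[_^-1]mul1r => hg.
  move=> /le_of_norm[h1 h2] /le_of_norm[h3 h4].
  by apply: norm_le_of; lra.
have each x : dot (strategy R L e l (u x) - gstar x) (sigma *: h x) - 2 * (delta + e%:R^-1 / 2)
    <= dot (strategy R L e l (u x) - gstar x) (sigma *: v x).
  have sd := strategy_simplex R L1 leL e0 (fun i _ => le_u x i).
  have := distribution_diff (w := fun i => sigma * (v x 0 i - h x 0 i))
    (c := delta + e%:R^-1 / 2) sd (gstar_simplex x).
  case/(_ _)/le_of_norm => [i|lo _]; first by rewrite normrM sigma1 mul1r.
  have -> : dot (strategy R L e l (u x) - gstar x) (sigma *: v x) =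
      dot (strategy R L e l (u x) - gstar x) (sigma *: h x) +
      \sum_i (strategy R L e l (u x) 0 i - gstar x 0 i) * (sigma * (v x 0 i - h x 0 i)).
    rewrite !dot_diffZ -big_split /=; apply: eq_bigr => i _.
    by ring.
  by rewrite lerD2l.
have := expect_le mu_dist each; rewrite expectB expect_cst // => H.
move: eps_e viol H; rewrite -/v; set d := expect _ _; set d' := expect _ _.
set r := e%:R^-1; clearbody d d' r => eps_e viol H; lra.
Qed.

Lemma Ind_strategy (eps : R) (T0 : nat) : (T0 <= T)%N -> 16 / e%:R <= eps ->
  ~ violated e l T mu gstar u ->
  Ind mu gstar T0 eps (fun x => strategy R L e l (u x)).
Proof.
move=> leT eps_e nv; split=> [x|f f_cube [b [c [szc _ cP]]]].
  exact: (strategy_simplex R L1 leL e0 (fun i _ => le_u x i)).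
have eps0 : 0 <= eps by rewrite (le_trans _ eps_e) // divr_ge0.
pose vs := [seq (fun x : n.-tuple bool => nth false x k) | k <- iota 0 n].
have vsE (x : n.-tuple bool) : [seq v x | v <- vs] = x.
  by rewrite -map_comp map_nth_iota // size_tuple.
(* The cases [sigma = 1] and [sigma = - 1] together bound the absolute value. *)
have key (sigma : R) : `|sigma| = 1 ->
    expect mu (fun x => dot (strategy R L e l (u x) - gstar x) (sigma *: f x)) <= eps.
  move=> sigma1; rewrite leNgt; apply/negP => /ltW viol; apply: nv.
  apply: (violated_intro (c := c) (b := b) (vs := vs) (delta := 0)
    (leq_trans szc leT) _ _ sigma1 eps_e _ viol).
  - by move=> v Hv; have [k _ ->] := In_map_iota Hv; left; right; exists k.
  - by move=> x i; rewrite vsE cP subrr normr0.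
  - by rewrite mulr0.
have scale sigma : expect mu (fun x => dot (strategy R L e l (u x) - gstar x) (sigma *: f x)) =
    sigma * expect mu (fun x => dot (strategy R L e l (u x) - gstar x) (f x)).
  rewrite -expectZ; apply: eq_expect => x; rewrite /dot mulr_sumr.
  by apply: eq_bigr => i _; rewrite [(_ *: f x) 0 i]mxE mulrCA.
have h1 := key 1; have h2 := key (- 1); rewrite !scale normrN normr1 in h1 h2.
have {}h1 := h1 erefl; have {}h2 := h2 erefl.
by apply: norm_le_of; lra.
Qed.

(** The gradient circuit reads the code of the strategy, whose bits are already wires of the state;
    for this reason [violated] gives tests access to [output_words]. *)
Lemma gradient_strategy (eps : R) (F : 'rV[R]_L -> 'rV[R]_L) (T0 : nat) :
  (T0 <= T)%N -> 16 / e%:R <= eps -> approx_computable F (eps / 4) T0 ->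
  ~ violated e l T mu gstar u ->
  expect mu (fun x => dot (strategy R L e l (u x) - gstar x) (F (strategy R L e l (u x)))) <= eps.
Proof.
move=> leT eps_e compF nv; rewrite leNgt; apply/negP => /ltW viol; apply: nv.
have [b' [c [szc _ cP]]] := compF (out_bits e l).
set b := out_bits e l in cP.
pose cd x := strategy_code R L e l (u x).
pose vs := [seq (fun x => encode_bit b (cd x) p) | p <- iota 0 (L * b.+2)].
have vsE x : [seq v x | v <- vs] = [seq encode_bit b (cd x) p | p <- iota 0 (L * b.+2)].
  by rewrite -map_comp.
have decE x : Defs.decode R b L [seq v x | v <- vs] = strategy R L e l (u x).
  rewrite vsE decode_encode // => i ltL.
  rewrite (leq_ltn_trans (strategy_code_le R L1 leL e0 (fun i _ => le_u x i) ltL)) //.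
  by rewrite ltn_exp2l.
apply: (violated_intro (c := c) (b := b') (vs := vs) (delta := eps / 4) (sigma := 1)
  (h := fun x => F (strategy R L e l (u x))) (leq_trans szc leT) _ _ _ eps_e).
- move=> v Hv; have [p ltp ->] := In_map_iota Hv; rewrite /encode_bit.
  case: (p %% b.+2)%N => [|j]; first by left; left.
  right; exists (p %/ b.+2)%N; first by rewrite ltn_divLR.
  by exists (b - j)%N => //; rewrite ltnS leq_subr.
- move=> x i; rewrite -decE; apply: cP.
    by rewrite !size_map size_iota.
  by rewrite decE; exact: (strategy_simplex R L1 leL e0 (fun i _ => le_u x i)).
- by rewrite normr1.
- by lra.
- by under eq_expect do rewrite scale1r.
Qed.

End Tests.

(** * Size of the circuit *)

Section PolynomialBounds.
Local Open Scope nat_scope.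
Implicit Types (f g : nat -> nat -> nat).

(** The constraint [0 < e] makes the base positive, so that exponents can be raised when two bounds
    are added. *)
Definition poly_bounded f : Prop :=
  exists c d, forall e l, 0 < e -> f e l <= c * (e + l) ^ d.

Lemma poly_bounded_le f g :
  poly_bounded g -> (forall e l, 0 < e -> f e l <= g e l) -> poly_bounded f.
Proof.
move=> [c [d gP]] fg; exists c, d => e l e0.
exact: leq_trans (fg e l e0) (gP e l e0).
Qed.

Lemma poly_bounded_cst k : poly_bounded (fun _ _ => k).
Proof. by exists k, 0 => e l _; rewrite expn0 muln1. Qed.

Lemma poly_bounded_fst : poly_bounded (fun e _ => e).
Proof. by exists 1, 1 => e l _; rewrite mul1n expn1 leq_addr. Qed.

Lemma poly_bounded_snd : poly_bounded (fun _ l => l).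
Proof. by exists 1, 1 => e l _; rewrite mul1n expn1 leq_addl. Qed.

Lemma poly_boundedM f g :
  poly_bounded f -> poly_bounded g -> poly_bounded (fun e l => f e l * g e l).
Proof.
move=> [c [d fP]] [c' [d' gP]]; exists (c * c'), (d + d') => e l e0.
by rewrite expnD mulnACA leq_mul ?fP ?gP.
Qed.

Lemma poly_boundedD f g :
  poly_bounded f -> poly_bounded g -> poly_bounded (fun e l => f e l + g e l).
Proof.
move=> [c [d fP]] [c' [d' gP]]; exists (c + c'), (d + d') => e l e0.
have el : 0 < e + l by rewrite addn_gt0 e0.
rewrite mulnDl leq_add //.
  by rewrite (leq_trans (fP e l e0)) // leq_mul2l leq_pexp2l ?leq_addr ?orbT.
by rewrite (leq_trans (gP e l e0)) // leq_mul2l leq_pexp2l ?leq_addl ?orbT.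
Qed.

Lemma poly_boundedX f k : poly_bounded f -> poly_bounded (fun e l => f e l ^ k).
Proof.
move=> fP; elim: k => [|k IH]; first exact: poly_bounded_cst.
by apply: poly_bounded_le (poly_boundedM fP IH) _ => e l _; rewrite expnS.
Qed.

Lemma up_log_lt N : 0 < N -> 2 ^ up_log 2 N <= 2 * N.
Proof.
case: N => [//|[|N]] _; first by rewrite up_log1.
have /= /andP[lt _] := up_log_bounds (isT : 1 < 2) (isT : 1 < N.+2).
have f0 : 0 < up_log 2 N.+2 by rewrite up_log_gt0.
by rewrite -(prednK f0) expnS leq_mul2l ltnW.
Qed.

Ltac pb := repeat first [ assumption | lazymatch goal with
  | |- poly_bounded (fun e l => @?f e l * @?g e l) => apply: (@poly_boundedM f g)
  | |- poly_bounded (fun e l => @?f e l + @?g e l) => apply: (@poly_boundedD f g)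
  | |- poly_bounded (fun e l => @?f e l ^ ?k) => apply: (@poly_boundedX f k)
  | |- poly_bounded (fun e l => e) => exact: poly_bounded_fst
  | |- poly_bounded (fun e l => l) => exact: poly_bounded_snd
  | |- _ => exact: poly_bounded_cst
  end ].

(** The cost per coordinate apart from the tests: [lc] bounds [level_cost / L], with [L.+1]
    estimated by [2 * L] and 8 by [8 * L]. *)
Definition overhead (e l : nat) : nat :=
  let lc := 2 * (sum_bits e l * 2 ^ (count_bits e l).+2 + sum_bits e l * 64) + 8 +
    (sum_bits e l * 2 ^ (count_bits e l).+2 + sum_bits e l * 64 +
     sum_bits e l * 2 ^ (count_bits e l).+2) + sum_bits e l * 32 in
  rounds e l * ((levels e l).+1 * lc +
    count_bits e l * 2 ^ (count_bits e l + (frac_bits e).+2).+2) +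
  (levels e l).+1 * lc + 1 + (out_bits e l).+2.

Lemma total_cost_le e l L T : 0 < L ->
  (rounds e l * iteration_cost L e l T + round_cost e l L).+1 + L * (out_bits e l).+2
  <= rounds e l * T + L * overhead e l.
Proof.
move=> L0; rewrite /overhead /iteration_cost /update_cost /round_cost /level_cost.
set a := sum_bits e l * 2 ^ _ + _; set a' := sum_bits e l * 2 ^ _.
set M := sum_bits e l * 32; set J := (levels e l).+1; set r := rounds e l.
set uc := count_bits e l * _; set o := (out_bits e l).+2.
have lc : L.+1 * a + 8 + (L * a + L * a') + L * M <= L * (2 * a + 8 + (a + a') + M).
  nia.
set lhs := _ + _ + _ + _ in lc *; set lc' := _ + _ + _ + _ in lc *.
have H1 : J * lhs <= L * (J * lc') by rewrite [leqRHS]mulnCA leq_mul2l lc orbT.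
have H2 : r * (J * lhs) <= L * (r * (J * lc')) by rewrite [leqRHS]mulnCA leq_mul2l H1 orbT.
move: (J * lhs) (J * lc') H1 H2 => x y H1 H2.
have L1 : 1 <= L by [].
have -> : r * (x + T + L * uc) = r * x + r * T + L * (r * uc).
  by rewrite !mulnDr mulnCA.
rewrite !mulnDr; clear -H1 H2 L1; lia.
Qed.

(** Powers of two occur only with exponents that are, up to constants, logarithms of polynomially
    bounded quantities. *)
Lemma poly_bounded_overhead : poly_bounded overhead.
Proof.
have pb_grain : poly_bounded (fun e _ => grain e).
  apply: (@poly_bounded_le _ (fun e _ => 4 * e)); first by pb.
  by move=> e l e0; have /andP[] := grain_bounds e0.
have pb_rounds : poly_bounded rounds.
  apply: (@poly_bounded_le _ (fun e l => 16 * e ^ 2 * (l + 1))); first by pb.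
  by move=> e l e0; rewrite addn1.
have pb_max : poly_bounded max_count by rewrite /max_count; pb.
have pb_count2 : poly_bounded (fun e l => 2 ^ count_bits e l).
  apply: (@poly_bounded_le _ (fun e l => 2 * (max_count e l + 1))); first by pb.
  by move=> e l e0; rewrite addn1 up_log_lt.
have pb_count : poly_bounded count_bits.
  by apply: poly_bounded_le pb_count2 _ => e l e0; rewrite ltnW // ltn_expl.
have pb_out : poly_bounded out_bits by rewrite /out_bits; pb.
have pb_sum : poly_bounded sum_bits by rewrite /sum_bits; pb.
have pb_levels : poly_bounded levels by rewrite /levels; pb.
have pb_levelsS : poly_bounded (fun e l => (levels e l).+1).
  apply: (@poly_bounded_le _ (fun e l => levels e l + 1)); first by pb.
  by move=> e l e0; rewrite addn1.
have pb_count4 : poly_bounded (fun e l => 2 ^ (count_bits e l).+2).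
  apply: (@poly_bounded_le _ (fun e l => 4 * 2 ^ count_bits e l)); first by pb.
  by move=> e l e0; rewrite !expnS; lia.
have pb_table : poly_bounded (fun e l => 2 ^ (count_bits e l + (frac_bits e).+2).+2).
  apply: (@poly_bounded_le _ (fun e l => 16 * 2 ^ count_bits e l * grain e)); first by pb.
  by move=> e l e0; rewrite addnS addnS !expnS expnD /grain; lia.
have pb_outS : poly_bounded (fun e l => (out_bits e l).+2).
  apply: (@poly_bounded_le _ (fun e l => out_bits e l + 2)); first by pb.
  by move=> e l e0; rewrite addn2.
by rewrite /overhead; pb.
Qed.

End PolynomialBounds.

(** * The converse bound *)

Section Clipping.
Variable R : realType.
Implicit Types (b : nat) (u : nat -> bool).

(* Saturation to [-1, 1] in two's complement: 10... becomes 110... = -1 and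
   01... becomes 010... = 1. *)
Definition clip_bit (j : nat) (u0 u1 uj : bool) : bool :=
  match j with 0 => u0 | 1 => u0 || u1 | _ => uj && (u0 == u1) end.

(** If the two leading bits differ, the value lies outside [[-1, 1[] and moves to the nearer
    endpoint, hence no farther from [y] in [[-1, 1]]; otherwise the code is unchanged. *)
Lemma clip_fixed_point b u (y : R) : - 1 <= y <= 1 ->
  let w := fun j => clip_bit j (u 0%N) (u 1%N) (u j) in
  - 1 <= fixed_point R b w <= 1 /\
  `|fixed_point R b w - y| <= `|fixed_point R b u - y|.
Proof.
move=> /andP[y0 y1] w.
have := fixed_point_trunc R 0 b u; rewrite add0n expr0 fixed_point0 divr1 => /andP[lo hi].
have pb : 0 < 1 / 2 ^+ b :> R by rewrite divr_gt0 // exprn_gt0.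
case: (eqVneq (u 0%N) (u 1%N)) => [E|ne].
  have -> : fixed_point R b w = fixed_point R b u.
    apply: eq_fixed_point => -[|[|j]] _; rewrite /w /clip_bit ?E ?orbb //.
    by rewrite eqxx andbT.
  split=> //; move: lo hi; rewrite E; case: (u 1%N) => /= lo hi;
    by apply/andP; split; lra.
have -> : fixed_point R b w = fixed_point R 0 w.
  elim: (b) => [//|k IH]; rewrite fixed_pointS IH /w /clip_bit (negPf ne) andbF.
  by rewrite mul0r addr0.
rewrite fixed_point0 /w /clip_bit; move: ne lo hi.
have h1 := ler_norm (fixed_point R b u - y).
have h2 := ler_norm (y - fixed_point R b u); rewrite distrC in h2.
move: (`|_|) h1 h2 => N h1 h2.
case: (u 0%N); case: (u 1%N) => //= _ lo hi.
  split; first by apply/andP; split; lra.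
  by apply: norm_le_of; lra.
split; first by apply/andP; split; lra.
by apply: norm_le_of; lra.
Qed.

End Clipping.

Section Converse.
Variables (R : realType) (n L T TPhi : nat) (eps : R).
Variables (F : 'rV[R]_L -> 'rV[R]_L) (g : n.-tuple bool -> 'rV[R]_L).
Hypotheses (F_cube : forall v, simplex v -> in_cube (F v))
  (compF : approx_computable F (eps / 4) TPhi)
  (g_simplex : forall x, simplex (g x)) (g_time : Time T g).

(** An approximate gradient may leave the cube, but test functions may not. Clipping repairs this
    without loss of accuracy, as the true gradient lies in the cube. *)
Lemma Time_gradient : exists f : n.-tuple bool -> 'rV[R]_L,
  [/\ forall x, in_cube (f x), Time (T + TPhi * 34).+1 f &
    forall x i, `|f x 0 i - F (g x) 0 i| <= eps / 4].
Proof.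
have [b [c [szc soc cP]]] := g_time.
have [b' [c' [szc' soc' cP']]] := compF b.
pose ins := [seq (fun x : n.-tuple bool => nth false x k) | k <- iota 0 n].
have insE (x : n.-tuple bool) : [seq v x | v <- ins] = x.
  by rewrite -map_comp map_nth_iota // size_tuple.
pose mids := [seq (fun x : n.-tuple bool => nth false (circuit_eval c x) p) | p <- iota 0 (L * b.+2)].
have midsE x : [seq v x | v <- mids] = circuit_eval c x.
  by rewrite -map_comp map_nth_iota // size_map.
pose y (x : n.-tuple bool) := circuit_eval c' (circuit_eval c x).
pose out p x := let i := (p %/ b'.+2)%N in
  clip_bit (p %% b'.+2) (nth false (y x) (i * b'.+2))
    (nth false (y x) (i * b'.+2 + 1)) (nth false (y x) p).
have A0 : @inputs n (fun=> false) by left.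
have H1 := derives_circuit (vs := ins) c A0.
have {}H1 : derives (size (circuit_gates c)) (@inputs n)
    [set f | exists k, f = fun x : n.-tuple bool => nth false (circuit_eval c x) k].
  apply: derives_mono (H1 _) => //.
    by move=> f [k ->]; exists k; apply: funext => x; rewrite insE.
  by move=> v Hv; have [k _ ->] := In_map_iota Hv; right; exists k.
have {}H1 := derives_keep H1.
set A1 := _ `|` _ in H1.
have H2 : derives (size (circuit_gates c')) A1
    [set f | exists k, f = fun x => nth false (y x) k].
  have := derives_circuit (vs := mids) (A := A1) c' (or_introl A0).
  move=> H; apply: derives_mono (H _) => //.
    by move=> f [k ->]; exists k; apply: funext => x; rewrite midsE.
  by move=> v Hv; have [k _ ->] := In_map_iota Hv; right; exists k.
have {H2}H2 := derives_trans H1 (derives_keep H2).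
set A2 := A1 `|` _ in H2.
have yA k : A2 (fun x => nth false (y x) k) by right; exists k.
have H3 : derives (L * b'.+2 * 32) A2
    [set f | exists2 p, (p < L * b'.+2)%N & f = out p].
  have := derives_family (m := (L * b'.+2)%N) (k := 32%N) (A := A2) (B := fun p => [set out p]).
  apply=> p _; set i := (p %/ b'.+2)%N.
  have := derives_lookup (A := A2) (vs := [:: (fun x => nth false (y x) (i * b'.+2)%N);
     (fun x => nth false (y x) (i * b'.+2 + 1)%N); (fun x => nth false (y x) p)])
   (fun s => clip_bit (p %% b'.+2) (nth false s 0) (nth false s 1) (nth false s 2))
   (or_introl (or_introl A0)).
  by apply=> v /= [<-|[<-|[<-|]]].
have [p ltp|d [szd sod dP]] := derives_realize (K := (L * b'.+2)%N) (F := out)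
  (derives_trans H2 H3).
  by exists p.
pose u (x : n.-tuple bool) (i : 'I_L) j := nth false (y x) (i * b'.+2 + j)%N.
have fE (x : n.-tuple bool) i : Defs.decode R b' L (circuit_eval d x) 0 i =
    fixed_point R b' (fun j => clip_bit j (u x i 0%N) (u x i 1%N) (u x i j)).
  rewrite mxE dP; apply: eq_fixed_point => j ltj.
  have ltp : (i * b'.+2 + j < L * b'.+2)%N.
    by rewrite (leq_trans (_ : _ < i.+1 * b'.+2)%N) ?leq_pmul2r // mulSn addnC ltn_add2r.
  rewrite (nth_map 0%N) ?size_iota // nth_iota // add0n /out.
  by rewrite modnMDl divnMDl // modn_small // divn_small // !addn0 /u addn0.
have uE (x : n.-tuple bool) i : Defs.decode R b' L (y x) 0 i = fixed_point R b' (u x i) by rewrite mxE.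
have gE (x : n.-tuple bool) : Defs.decode R b L (circuit_eval c x) = g x by rewrite cP.
have clipped (x : n.-tuple bool) i := clip_fixed_point b' (u x i) (F_cube (g_simplex x) i).
exists (fun x : n.-tuple bool => Defs.decode R b' L (circuit_eval d x)); split.
- by move=> x i; rewrite fE; have [] := clipped x i.
- exists b', d; split=> //; apply: (leq_trans szd).
  (* Output bits count in [circuit_size], so there are at most [TPhi] of them. Per bit, 32 clipping
     gates and one output, together with the gates of [c'], give the factor 34. *)
  have := leq_trans (leq_addl _ _) szc'; rewrite soc' => le1.
  have le2 := leq_trans (leq_addr _ _) szc'.
  have le3 := leq_trans (leq_addr _ _) szc.
  by move: le1 le2 le3; set q := (L * b'.+2)%N; lia.
- move=> x i; rewrite fE; have [_ le] := clipped x i; apply: (le_trans le).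
  rewrite -uE -gE; apply: cP'; last by rewrite gE.
  by rewrite size_map soc.
Qed.

End Converse.

(** * Bregman divergences and entropy gaps *)

Section Duality.
Variables (R : realType) (n L : nat) (mu : n.-tuple bool -> R).
Hypothesis mu_dist : is_distribution mu.
Variables (phi : 'rV[R]_L -> R) (grad : 'rV[R]_L -> 'rV[R]_L).
Hypothesis grad_sub : is_subgradient phi grad.
Implicit Types s g gstar : n.-tuple bool -> 'rV[R]_L.

(** All values of [phi] cancel and only the linear term of the divergence remains; bounding it by
    [eps] is the entropy inequality of the direct part. *)
Lemma bregman_entropy gstar s :
  bregman mu phi grad gstar s - (entropy mu phi s - entropy mu phi gstar) =
  expect mu (fun x => dot (s x - gstar x) (grad (s x))).
Proof.
rewrite /bregman /entropy opprK [- _ + _]addrC -expectB -expectB.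
apply: eq_expect => x; rewrite opprB addrCA [X in _ + X]addrAC.
have -> : dot (gstar x - s x) (grad (s x)) = - dot (s x - gstar x) (grad (s x)).
  by rewrite /dot -sumrN; apply: eq_bigr => i _; rewrite !mxE; ring.
by ring.
Qed.

(** The subgradient inequality at [g x], tested against [s x] and averaged over [mu]. *)
Lemma entropy_gap_le gstar s g :
  (forall x, simplex (s x)) -> (forall x, simplex (g x)) ->
  entropy mu phi s - entropy mu phi gstar <= bregman mu phi grad gstar g -
    expect mu (fun x => dot (s x - gstar x) (grad (g x))).
Proof.
move=> ss gs; rewrite /bregman /entropy opprK [- _ + _]addrC -!expectB.
apply: (expect_le mu_dist) => x.
have := grad_sub (ss x) (gs x).
have -> : dot (s x - gstar x) (grad (g x)) =
    dot (s x - g x) (grad (g x)) - dot (gstar x - g x) (grad (g x)).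
  by rewrite /dot -sumrB; apply: eq_bigr => i _; rewrite !mxE; ring.
lra.
Qed.

Lemma converse_bound (T TPhi : nat) (eps : R) gstar s g :
  (forall v, simplex v -> in_cube (grad v)) ->
  approx_computable grad (eps / 4) TPhi ->
  (forall x, simplex (gstar x)) -> (forall x, simplex (g x)) -> Time T g ->
  Ind mu gstar (T + TPhi * 34).+1 (eps / 2) s ->
  entropy mu phi s - entropy mu phi gstar <= bregman mu phi grad gstar g + eps.
Proof.
move=> grad_cube compF gstars gs gT [ss ind].
have [f [f_cube fT f_close]] := Time_gradient grad_cube compF gs gT.
apply: (le_trans (entropy_gap_le gstar ss gs)); rewrite lerD2l.
have /le_of_norm[lo _] := ind f f_cube fT.
have each x : dot (s x - gstar x) (f x) - 2 * (eps / 4) <=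
    dot (s x - gstar x) (grad (g x)).
  have := distribution_diff (w := fun i => f x 0 i - grad (g x) 0 i) (c := eps / 4)
    (ss x) (gstars x).
  case/(_ _)/le_of_norm => [i|_ hi]; first exact: f_close.
  rewrite lerBlDr -lerBlDl; apply: le_trans hi.
  rewrite /dot -sumrB le_eqVlt; apply/orP; left; apply/eqP; apply: eq_bigr => i _.
  by rewrite !mxE; ring.
(* The approximation costs [2 * (eps / 4)] and indistinguishability [eps / 2]. *)
have := expect_le mu_dist each; rewrite expectB expect_cst //.
move: lo; set d := expect _ _; set d' := expect _ _.
clearbody d d'; lra.
Qed.

End Duality.

Lemma converse_direction (R : realType) (n L : nat) (mu : n.-tuple bool -> R) (eps : R)
    (I : Type) (phi : I -> 'rV[R]_L -> R) (grad : I -> 'rV[R]_L -> 'rV[R]_L) (TPhi T : nat) :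
  is_distribution mu ->
  (forall k, is_subgradient (phi k) (grad k)) ->
  (forall k v, simplex v -> in_cube (grad k v)) ->
  (forall k, approx_computable (grad k) (eps / 4) TPhi) ->
  forall gstar : n.-tuple bool -> 'rV[R]_L, (forall x, simplex (gstar x)) -> forall k,
  (ereal_sup [set (entropy mu (phi k) s - entropy mu (phi k) gstar)%:E
                | s in Ind mu gstar (T + TPhi * 34).+1 (eps / 2)]
   <= ereal_inf [set (bregman mu (phi k) (grad k) gstar g)%:E
                   | g in [set g | Time T g /\ forall x, simplex (g x)]] + eps%:E)%E.
Proof.
move=> mu_dist sub cube comp gstar gstars k.
apply: ge_ereal_sup => _ [s sInd <-].
rewrite -leeBlDr //; apply: le_ereal_inf_tmp => _ [g [gT gs] <-].
rewrite -EFinB lee_fin lerBlDr.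
exact: (converse_bound mu_dist (sub k) (cube k) (comp k) gstars gs gT sInd).
Qed.

(** * Numerical bounds and assembly of both directions *)

Section Direct.
Variables (R : realType) (n : nat) (mu : n.-tuple bool -> R).
Hypothesis mu_dist : is_distribution mu.

Lemma ln_ge_half L : (1 < L)%N -> 1 / 2 <= ln L%:R :> R.
Proof.
move=> L1; rewrite -[leLHS]expRK ler_ln ?posrE ?expR_gt0 ?ltr0n 1?ltnW //.
apply: (@le_trans _ _ 2); last by rewrite ler_nat.
by have := expR_le_quadratic (a := 1 / 2 : R); rewrite expr2; lra.
Qed.

(** Rounding up costs at most 1, and both [1 <= 2 * ln L] and [1 <= 2 * ln 2] hold. *)
Lemma up_log_le_ln L : (1 < L)%N -> (up_log 2 L)%:R <= 4 * ln L%:R :> R.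
Proof.
move=> L1; have h := ln_ge_half L1.
have /= /andP[lt _] := up_log_bounds (isT : (1 < 2)%N) L1.
have f0 : (0 < up_log 2 L)%N by rewrite up_log_gt0.
have : (up_log 2 L).-1%:R * ln 2 <= ln L%:R :> R.
  rewrite mulr_natl -lnXn // ler_ln ?posrE ?exprn_gt0 ?ltr0n 1?ltnW //.
  by rewrite -natrX ler_nat ltnW.
have h2 := @ln_ge_half 2 isT.
rewrite -{2}(prednK f0) -natr1; set p := _.-1%:R; have p0 : 0 <= p :> R by [].
have : p * (1 / 2) <= p * ln 2 by rewrite ler_wpM2l.
by lra.
Qed.

Lemma direct_large L (T TPhi e l : nat) (eps : R)
    (I : Type) (phi : I -> 'rV[R]_L -> R) (grad : I -> 'rV[R]_L -> 'rV[R]_L)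
    (gstar : n.-tuple bool -> 'rV[R]_L) :
  (1 < L)%N -> (L <= 2 ^ l)%N -> (0 < e)%N -> 16 / e%:R <= eps ->
  (forall k, approx_computable (grad k) (eps / 4) TPhi) ->
  (forall x, simplex (gstar x)) ->
  exists s : n.-tuple bool -> 'rV[R]_L,
    [/\ Ind mu gstar T eps s,
        Time (rounds e l * (T + TPhi) + L * overhead e l) s &
        forall k, entropy mu (phi k) s - entropy mu (phi k) gstar
                    >= bregman mu (phi k) (grad k) gstar s - eps].
Proof.
move=> L1 leL e0 eps_e comp gstars.
(* Tests and gradients share the single time budget [T + TPhi]. *)
have [t [u [let_ ru nv]]] := exists_unviolated (T + TPhi) L1 leL e0 mu_dist gstars.
have le_u := max_count_bound let_ (let: And3 H _ _ := ru in H).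
exists (fun x => strategy R L e l (u x)); split.
- exact: (Ind_strategy L1 leL e0 mu_dist gstars le_u (leq_addr _ _) eps_e nv).
- apply: (Time_strategy L1 leL e0 let_ ru).
  exact: (total_cost_le e l (T + TPhi) (ltnW L1)).
- move=> k.
  have := gradient_strategy L1 leL e0 mu_dist gstars le_u (leq_addl T TPhi) eps_e (comp k) nv.
  rewrite -(bregman_entropy mu (phi k)); lra.
Qed.

(** Finding a rejected level needs two coordinates, so [L = 1] is separate: the simplex is a point
    and [gstar], the constant 1, serves itself. The time 7 is four gates for the bit 1, one for
    [false], and two outputs. *)
Lemma direct_single (eps : R)
    (I : Type) (phi : I -> 'rV[R]_1 -> R) (grad : I -> 'rV[R]_1 -> 'rV[R]_1)
    (gstar : n.-tuple bool -> 'rV[R]_1) T : 0 <= eps ->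
  (forall x, simplex (gstar x)) ->
  exists s : n.-tuple bool -> 'rV[R]_1,
    [/\ Ind mu gstar T eps s, Time 7 s &
        forall k, entropy mu (phi k) s - entropy mu (phi k) gstar
                    >= bregman mu (phi k) (grad k) gstar s - eps].
Proof.
move=> eps0 gstars; exists gstar; split.
- split=> // f _ _; rewrite (_ : expect _ _ = 0) ?normr0 //.
  rewrite /expect big1 // => x _; rewrite subrr /dot big1 ?mulr0 // => i _.
  by rewrite mxE mul0r.
- have -> : gstar = fun x => \row_(i < 1) (1%:R / 2 ^+ 0).
    apply: funext => x; apply/rowP => i; rewrite mxE expr0 divr1 (ord1 i).
    by have [_] := gstars x; rewrite big_ord1.
  apply: (@Time_derives R n 1 0 4 7 (fun _ _ => 1%N)) => //.
  apply: derives_mono (derives_lookup (vs := [::]) (A := @inputs n) (fun=> true) _ _) => //.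
  + by move=> f [[|i] // _ [[|k] // _ ->]]; apply: funext => x; rewrite bit0.
  + by left.
- move=> k; have := bregman_entropy mu (phi k) (grad k) gstar gstar.
  rewrite (_ : expect mu (fun x => dot _ _) = 0); first by lra.
  rewrite /expect big1 // => x _; rewrite subrr /dot big1 ?mulr0 // => i _.
  by rewrite mxE mul0r.
Qed.

End Direct.

Lemma rounds_le (R : realType) (e l : nat) (x y : R) :
  e%:R <= 17 * x -> l%:R <= 4 * y -> 1 / 2 <= y ->
  (rounds e l)%:R <= 16 * 17 ^+ 2 * 6 * (y * x ^+ 2).
Proof.
move=> ex ly y2; rewrite /rounds !natrM -[l.+1%:R]natr1.
have e2 : e%:R * e%:R <= (17 * x) * (17 * x) :> R by rewrite ler_pM.
have l1 : l%:R + 1 <= 6 * y by lra.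
have -> : 16 * 17 ^+ 2 * 6 * (y * x ^+ 2) = 16 * ((17 * x) * (17 * x)) * (6 * y) by ring.
apply: ler_pM l1; rewrite ?mulr_ge0 ?addr_ge0 //.
by rewrite ler_pM2l.
Qed.

Lemma overhead_real_bound (R : realType) : exists (c : R) (d : nat), 0 <= c /\
  forall (e l : nat) (x y : R), (0 < e)%N -> e%:R <= 17 * x -> l%:R <= 4 * y -> 0 <= y ->
  (overhead e l)%:R <= c * (x + y) ^+ d.
Proof.
have [c [d H]] := poly_bounded_overhead.
exists (c%:R * 17 ^+ d), d; split=> [|e l x y e0 ex ly y0].
  by rewrite mulr_ge0 ?exprn_ge0.
apply: (@le_trans _ _ (c * (e + l) ^ d)%:R); first by rewrite ler_nat H.
rewrite natrM natrX natrD -mulrA -exprMn ler_wpM2l // lerXn2r ?nnegrE ?addr_ge0 //.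
  have : 0 <= 17 * x by apply: le_trans ex.
  lra.
lra.
Qed.

Theorem theorem1p10 (R : realType) :
  exists (C : R) (P : {poly {poly R}}),
  forall (n L : nat) (mu : n.-tuple bool -> R) (eps : R)
    (I : Type) (phi : I -> 'rV[R]_L -> R) (grad : I -> 'rV[R]_L -> 'rV[R]_L)
    (TPhi : nat),
  (0 < n)%N -> (0 < L)%N ->
  is_distribution mu ->
  0 < eps < 1 ->
  (forall k, convex_function (@simplex R L) (phi k)) ->
  (forall k, is_subgradient (phi k) (grad k)) ->
  (forall k v, simplex v -> in_cube (grad k v)) ->
  (forall k, approx_computable (grad k) (eps / 4) TPhi) ->
  (forall T : nat, (0 < T)%N ->
    exists T' : nat,
      T'%:R <= C * ((T + TPhi)%:R * ln L%:R / eps ^+ 2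
                    + L%:R * P.[(1 / eps)%:P].[ln L%:R]) /\
      forall gstar : n.-tuple bool -> 'rV[R]_L,
        (forall x, simplex (gstar x)) ->
        exists s : n.-tuple bool -> 'rV[R]_L,
          [/\ Ind mu gstar T eps s,
              Time T' s &
              forall k,
                entropy mu (phi k) s - entropy mu (phi k) gstar
                  >= bregman mu (phi k) (grad k) gstar s - eps]) /\
  (forall T : nat, (0 < T)%N ->
    exists T' : nat,
      T'%:R <= C * (T + TPhi)%:R /\
      forall gstar : n.-tuple bool -> 'rV[R]_L,
        (forall x, simplex (gstar x)) ->
        forall k,
          (ereal_sup [set (entropy mu (phi k) s - entropy mu (phi k) gstar)%:E
                        | s in Ind mu gstar T' (eps / 2)]
           <= ereal_inf [set (bregman mu (phi k) (grad k) gstar g)%:E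
                           | g in [set g | Time T g
                                           /\ forall x, simplex (g x)]]
              + eps%:E)%E).
Proof.
have [c [d [c0 over]]] := overhead_real_bound R.
pose C : R := 16 * 17 ^+ 2 * 6.
have C35 : 35 <= C by rewrite /C !exprS expr0; lra.
(* The outer variable stands for [1 / eps], the inner one for [ln L]. The factor [1 + c] keeps the
   value at least 1 when [L = 1], which pays for the constant time there. *)
exists C, ((1 + c)%:P%:P * ('X + ('X)%:P) ^+ d).
move=> n L mu eps I phi grad TPhi _ L0 mu_dist /andP[eps0 eps1] _ sub cube comp.
have PE : ((1 + c)%:P%:P * ('X + ('X)%:P) ^+ d).[(1 / eps)%:P].[ln L%:R] =
    (1 + c) * (1 / eps + ln L%:R) ^+ d.
  by rewrite !(hornerM, horner_exp, hornerD, hornerC, hornerX).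
have ie1 : 1 <= 1 / eps by rewrite ler_pdivlMr // mul1r ltW.
split=> T T0; last first.
  exists (T + TPhi * 34).+1; split; last exact: converse_direction.
  (* The successor is absorbed because [T] is positive. *)
  apply: (@le_trans _ _ (35 * (T + TPhi)%:R)); last by rewrite ler_wpM2r.
  by rewrite -natrM ler_nat; lia.
rewrite PE; have [L1|Lle] := ltnP 1 L; last first.
  have EL : L = 1%N by apply/eqP; rewrite eqn_leq Lle.
  subst L; exists 7%N; split; last first.
    by move=> gstar gstars; exact: (direct_single mu phi grad T (ltW eps0)).
  rewrite ln1 mulr0 mul0r add0r addr0 !mul1r.
  have : 1 <= eps^-1 ^+ d by rewrite exprn_ege1 // -[leRHS]mul1r.
  set z := _ ^+ d => z1.
  have z2 : 1 <= (1 + c) * z by rewrite mulrDl mul1r; have := mulr_ge0 c0 (le_trans ler01 z1); lra.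
  have : 35 * 1 <= C * ((1 + c) * z) by apply: ler_pM.
  by apply: le_trans; rewrite mulr1 ler_nat.
(* The least integer above [16 / eps]; since [eps < 1], the added 1 is at most [1 / eps], whence the
   factor 17. *)
pose e := (Num.truncn (16 / eps)).+1; pose l := up_log 2 L.
have /truncn_itv/andP[te1 te2] : 0 <= 16 / eps by rewrite divr_ge0 // ltW.
have e_le : e%:R <= 17 * (1 / eps).
  rewrite /e -natr1; have -> : 17 * (1 / eps) = 16 / eps + 1 / eps by field; rewrite gt_eqF.
  by rewrite lerD.
have eps_e : 16 / e%:R <= eps.
  by rewrite ler_pdivrMr ?ltr0n // mulrC -ler_pdivrMr // ltW.
have l_le := up_log_le_ln R L1.
have ln_half := ln_ge_half R L1.
exists (rounds e l * (T + TPhi) + L * overhead e l)%N; split; last first.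
  move=> gstar gstars.
  by apply: direct_large => //; exact: up_logP.
rewrite natrD mulrDr [(rounds e l * _)%:R]natrM [(L * _)%:R]natrM; apply: lerD.
  have := rounds_le e_le l_le ln_half; rewrite -/C => H.
  have -> : C * ((T + TPhi)%:R * ln L%:R / eps ^+ 2) =
      C * (ln L%:R * (1 / eps) ^+ 2) * (T + TPhi)%:R.
    by field; rewrite gt_eqF.
  by rewrite ler_wpM2r.
have := over e l (1 / eps) (ln L%:R) isT e_le l_le (le_trans _ ln_half).
move=> /(_ _) H.
have {}H : (overhead e l)%:R <= c * (1 / eps + ln L%:R) ^+ d by apply: H; lra.
set z := (_ + _) ^+ d in H *.
have z0 : 0 <= z by rewrite exprn_ge0 // addr_ge0 //; lra.
rewrite mulrCA ler_wpM2l // (le_trans H) //.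
have h1 : c * z <= (1 + c) * z by rewrite ler_wpM2r // lerDr.
apply: (le_trans h1); rewrite ler_peMl //; last lra.
by rewrite mulr_ge0 // addr_ge0.
Qed.
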